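(* Let the graph $\mathcal{G}^P$ be a lattice or its $r$-fuzz in one or two dimensions ($d=1$ or $d=2$), and let the line susceptances $b_{ij}$ be bounded. Let all system parameters and controller gains be fixed, i.e. they do not change as the network size $n$ grows. Then the per-node losses associated with measurement noise scale according to $$\frac1n\|\mathcal{S}^{\mathrm{DAPI}}_\eta\|_2^2\sim\begin{cases}\varepsilon^2 n&\text{if } d=1,\\ \varepsilon^2\log n&\text{if } d=2,\end{cases}$$ where the notation $u(n)\sim v(n)$ implies that $\underline c\,v(n)\le u(n)\le\bar c\,v(n)$ for sufficiently large $n$, where $\underline c,\bar c$ are positive constants. The per-node losses associated with power injection noise are, on the other hand, upper bounded as $$\frac1n\|\mathcal{S}^{\mathrm{DAPI}}_P\|_2^2\le\frac{\alpha}{2k}.$$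
   Context: A 1-dimensional lattice corresponds to a path graph. The $r$-fuzz of a lattice graph is created by adding edges between all nodes that are at a graph distance of $r$ or less from each other. $\mathcal{G}^P$ is a connected undirected graph on $n$ nodes with edge weights (line susceptances) $b_{ij}=b_{ji}>0$, and $\mathcal{L}_B$ is its weighted Laplacian ($[\mathcal{L}_B]_{ij}=-b_{ij}$ for $i\neq j$, $[\mathcal{L}_B]_{ii}=\sum_{j\ne i}b_{ij}$, with $b_{ij}=0$ for non-edges), with eigenvalues $0=\lambda_1<\lambda_2\le\dots\le\lambda_n$. The power network under distributed averaging proportional-integral (DAPI) control is $$\dot\theta=\omega,\qquad \tau\dot\omega=-k\mathcal{L}_B\theta-\omega+\Omega+P,\qquad q\dot\Omega=-\omega-\gamma\mathcal{L}_B\Omega+\eta,$$ with output $y=\mathcal{L}_G^{1/2}\theta$, where $\theta$, $\omega$ and $\Omega$ are the vectors of phase angles, frequency deviations and integral states, $P$ is unit-intensity white power injection noise, $\eta=\varepsilon w_\eta$ is frequency measurement noise with $w_\eta$ unit-intensity white noise uncorrelated with $P$, and $\mathcal{L}_G=\alpha\mathcal{L}_B$. The expected transient power losses (the parts of the squared $\mathcal{H}_2$ norm of this system due to $P$ and $\eta$, respectively) are $$\|\mathcal{S}^{\mathrm{DAPI}}_P\|_2^2=\frac{\alpha}{2k}\sum_{i=2}^n\frac{1}{1+\varphi(\lambda_i,\gamma,k,q,\tau)^{-1}},\qquad \|\mathcal{S}^{\mathrm{DAPI}}_\eta\|_2^2=\varepsilon^2\frac{\alpha}{2k}\sum_{i=2}^n\frac{1}{\gamma\lambda_i}\cdot\frac{1}{1+\varphi(\lambda_i,\gamma,k,q,\tau)},$$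 where $$\varphi(\lambda_i,\gamma,k,q,\tau)=\frac{kq^2\lambda_i+q\gamma\lambda_i+\tau(\gamma\lambda_i)^2}{q+\tau\gamma\lambda_i}.$$ Here $\alpha>0$ is the uniform conductance-to-susceptance ratio of the lines, $k>0$ the droop gain, $\tau>0$ the time constant, $q>0$ the integral gain, $\gamma>0$ the distributed averaging gain (the communication graph is identical to $\mathcal{G}^P$, with weights $c_{ij}=\gamma b_{ij}$), and $\varepsilon>0$ the noise intensity parameter. Per-node losses are the losses divided by the number of nodes $n$.
   Formalization: ''Bounded'' line susceptances is taken to mean bounded above and bounded below by a positive constant independent of n; with only an upper bound the measurement-noise scaling fails (e.g. all b_ij = 1/n on the path graph gives losses of order n^2). *)

(* Defs.v *)
From HB Require Import structures.
From mathcomp Require Import all_boot all_order all_algebra.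
From mathcomp Require Import all_classical all_reals all_analysis.
Set Implicit Arguments.
Unset Strict Implicit.
Unset Printing Implicit Defensive.
Import Order.TTheory GRing.Theory Num.Theory.
Import numFieldNormedType.Exports.
Local Open Scope classical_set_scope.
Local Open Scope ring_scope.

(* {0, ..., N-1}^d: the square lattice of side N, with N ^ d nodes; the path
   graph on N nodes when d = 1. *)
Definition node (d N : nat) : finType := {ffun 'I_d -> 'I_N}.

Definition lattice_adj (d N : nat) : rel (node d N) := fun x y =>
  [exists i : 'I_d,
     (((x i : nat).+1 == y i) || ((y i : nat).+1 == x i))
     && [forall j : 'I_d, (j != i) ==> (x j == y j)]].

Definition graph_dist_le (T : finType) (e : rel T) (r : nat) : rel T :=
  fun x y =>
  [exists l : 'I_r.+1, exists p : (nat_of_ord l).-tuple T,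
     path e x p && (last x p == y)].

Definition fuzz (T : finType) (r : nat) (e : rel T) : rel T :=
  fun x y => (x != y) && graph_dist_le e r x y.

(* A loopless graph is its own 1-fuzz, so a statement about the r-fuzz of a
   lattice for all r > 0 covers the lattice itself. *)
Lemma fuzz1 (T : finType) (e : rel T) : irreflexive e -> fuzz 1 e =2 e.
Proof.
move=> irr x y; apply/andP/idP => [[xy /existsP[l /existsP[p]]]|exy].
  case: l p => [[|[|l]]] //= ? p; first by rewrite tuple0 /= (negPf xy).
  by case/tupleP: p => z p; rewrite tuple0 /= andbT => /andP[exz /eqP <-].
split; first by apply: contraTneq exy => ->; rewrite irr.
apply/existsP; exists ord_max; apply/existsP; exists [tuple y] => /=.
by rewrite exy eqxx.
Qed.

Lemma lattice_adj_irr (d N : nat) : irreflexive (@lattice_adj d N).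
Proof.
move=> x; apply/negbTE; rewrite negb_exists; apply/forallP => i.
by rewrite orbb gtn_eqF.
Qed.

(* Line susceptances on the graph e; lo and hi are meant to be chosen
   independently of the size of the network. *)
Definition bounded_susceptances (R : realType) (T : finType) (e : rel T)
    (lo hi : R) (b : T -> T -> R) : Prop :=
  [/\ forall x y, b x y = b y x,
      forall x y, ~~ e x y -> b x y = 0
    & forall x y, e x y -> lo <= b x y <= hi].

Definition laplacian (R : realType) (T : finType) (b : T -> T -> R) :
    'M[R]_#|T| :=
  \matrix_(i, j)
    if i == j then \sum_(v | v != enum_val i) b (enum_val i) v
    else - b (enum_val i) (enum_val j).

Definition psdmx (R : realType) (n : nat) (S : 'M[R]_n) : Prop :=
  S^T = S /\ forall v : 'rV[R]_n, 0 <= (v *m S *m v^T) 0 0.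

(* The unique symmetric positive semidefinite square root of M; the default
   value 0 is taken only if M is not itself symmetric positive semidefinite. *)
Definition sqrtmx (R : realType) (n : nat) (M : 'M[R]_n) : 'M[R]_n :=
  xget 0 [set S : 'M[R]_n | psdmx S /\ S *m S = M].

Definition expmx (R : realType) (n : nat) (A : 'M[R]_n) : 'M[R]_n :=
  \matrix_(i, j) limn (series (fun m => (m`!%:R)^-1 * (A ^+ m) i j)).

(* Squared H2 norm of x' = A x + B w, y = C x: the energy of the impulse
   response C e^(tA) B. The integral is extended-real valued because A need not
   be Hurwitz (in a power network the mean phase angle is a marginally stable
   unobservable mode). *)
Definition H2norm_sq (R : realType) (n m p : nat)
    (A : 'M[R]_n) (B : 'M[R]_(n, m)) (C : 'M[R]_(p, n)) : \bar R :=
  (\int[lebesgue_measure]_(t in `[0%R, +oo[)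
     let h := C *m expmx (t *: A) *m B in (\tr (h^T *m h))%:E)%E.

Section DAPI.
Variables (R : realType) (n : nat) (L : 'M[R]_n).
Variables (alpha gamma k q tau eps : R).

(* State (theta, omega, Omega). *)
Definition dapiA : 'M[R]_(n + (n + n)) :=
  block_mx
    0                       (row_mx 1%:M 0)
    (col_mx (- (k / tau) *: L) 0)
                            (block_mx (- tau^-1)%:M (tau^-1)%:M
                                      (- q^-1)%:M   (- (gamma / q) *: L)).

Definition dapiB_P : 'M[R]_(n + (n + n), n) :=
  col_mx 0 (col_mx (tau^-1)%:M 0).

(* Input w_eta, where eta = eps w_eta. *)
Definition dapiB_eta : 'M[R]_(n + (n + n), n) :=
  col_mx 0 (col_mx 0 (eps / q)%:M).

Definition dapiC : 'M[R]_(n, n + (n + n)) :=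
  row_mx (sqrtmx (alpha *: L)) 0.

Definition dapi_loss_P : \bar R := H2norm_sq dapiA dapiB_P dapiC.
Definition dapi_loss_eta : \bar R := H2norm_sq dapiA dapiB_eta dapiC.

End DAPI.

Definition per_node (R : realType) (T : finType) (loss : \bar R) : \bar R :=
  ((#|T|%:R^-1)%:E * loss)%E.

Definition scales_as (R : realType) (u : nat -> \bar R) (v : nat -> R) : Prop :=
  exists c_lo c_hi : R,
    [/\ 0 < c_lo, 0 < c_hi
      & \forall N \near \oo,
          ((c_lo * v N)%:E <= u N)%E /\ (u N <= (c_hi * v N)%:E)%E].

(* Main.v *)
Require Import Defs.
From HB Require Import structures.
From mathcomp Require Import all_boot all_order all_algebra.
From mathcomp Require Import all_classical all_reals all_analysis.
From mathcomp Require Import measurable_realfun.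
From mathcomp Require Import ring lra.
From mathcomp Require Import complex.
Set Implicit Arguments.
Unset Strict Implicit.
Unset Printing Implicit Defensive.
Import Order.TTheory GRing.Theory Num.Theory.
Import numFieldNormedType.Exports.
Local Open Scope classical_set_scope.
Local Open Scope ring_scope.

(** Both losses are sums over the nonzero eigenvalues of the weighted Laplacian L,
    and the theorem is about how such sums grow with the network.

    The real spectral theorem ([symmetric_spectral]) turns L into a diagonal matrix
    of eigenvalues lambda_i >= 0 in an orthonormal basis. In that basis the closed
    loop splits into independent three-dimensional systems, one per eigenvalue, and
    the output energy is alpha times the sum of lambda_i theta_i^2. For lambda > 0
    a quadratic form Q with Q' = - theta^2 along trajectories is found by solving a
    Lyapunov equation; every trajectory tends to 0, so the energy of theta is
    exactly the initial value of Q ([mode_loss]). Modes with lambda = 0 are not seen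
    by the output. Hence ([dapi_loss_modes]) each loss is an explicit finite sum.
    For power noise a mode contributes at most alpha / (2 k), which is the second
    claim. For measurement noise the contribution is between two constant multiples
    of eps^2 / lambda, because lambda stays bounded ([dapi_loss_eta_bounds]).

    It remains to see how the sum of the 1 / lambda_i grows. Replacing L by another
    Laplacian L0 whose energy form is equivalent to that of L changes this sum by at
    most a constant factor ([spectral_compare]). The energy of the weighted fuzz is
    equivalent to the energy of the plain lattice, with constants depending only on
    r, d and the bounds on the susceptances: a long edge is a walk of at most r
    lattice edges, and a lattice edge lies on boundedly many such walks
    ([energy_ge], [energy_le]).

    The plain lattice is diagonalised by products of cosines, with eigenvalues of
    the order of |kappa|^2 / N^2 for nonzero frequencies kappa in {0, ..., N - 1}^d
    ([lattice_eigenbasis], [lattice_eig_bounds]). So everything rests on the sum of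
    |kappa|^-2: it is bounded for d = 1 and of order log N for d = 2. Multiplying by
    N^2 and dividing by the number N^d of nodes gives n = N, respectively log N,
    which is half of log n. *)

(** * Spectral theorem over the reals *)

(** Over the complex extension R[i] a symmetric real matrix is Hermitian, hence
    has an eigenvector with a real eigenvalue. Its real and imaginary parts are
    then real eigenvectors for the same eigenvalue, unless they vanish, and they do
    not both vanish. *)
Lemma symmetric_eigenvector (R : rcfType) n (A : 'M[R]_n.+1) : A^T = A ->
  exists (v : 'rV[R]_n.+1) (l : R), v != 0 /\ v *m A = l *: v.
Proof.
move=> symA; pose Ac := map_mx (real_complex R) A.
have hA : Ac \is hermsymmx.
  apply/is_hermitianmxP; rewrite expr0 scale1r.
  apply/matrixP => i j; rewrite !mxE -{1}symA mxE.
  by apply/esym/CrealP/complex_realP; exists (A j i).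
have /orthomx_spectralP eA := hermitian_normalmx hA.
have dreal := hermitian_spectral_diag_real hA.
set P := spectralmx Ac in eA; set D := spectral_diag Ac in eA dreal.
have uP : P \in unitmx by exact: spectral_unit.
have PA : P *m Ac = diag_mx D *m P by rewrite eA !mulmxA mulmxV // mul1mx.
have /complex_realP[l dl] : D 0 0 \is Num.real by exact: mxOverP.
pose v : 'rV_n.+1 := row 0 P.
have vA : v *m Ac = D 0 0 *: v.
  by rewrite /v -row_mul PA; apply/rowP => j; rewrite mul_diag_mx !mxE.
have v0 : v != 0.
  apply: contraTneq uP => v0; rewrite -row_free_unit; apply/negP => /row_freeP[Q PQ].
  have := congr1 (row 0) PQ; rewrite row_mul -/v v0 mul0mx => /matrixP/(_ 0 0).
  by rewrite !mxE eqxx => /eqP; rewrite eq_sym oner_eq0.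
(* f stands for the real part and for the imaginary part. *)
have key (f : R[i] -> R) (hf : {morph f : x y / x + y})
    (hs : forall (a : R) x, f (x * (real_complex R a)) = f x * a) :
    map_mx f v *m A = l *: map_mx f v.
  have f0 : f 0 = 0 by have := hs 0 0; rewrite mul0r mulr0.
  apply/rowP => j; have /rowP/(_ j) := vA; rewrite !mxE => /(congr1 f).
  rewrite (big_morph f hf f0) dl mulrC hs mulrC => <-.
  by apply: eq_bigr => k _; rewrite !mxE hs.
have [rv0|rv0] := eqVneq (map_mx (@complex.Re R) v) 0; last first.
  exists (map_mx (@complex.Re R) v), l; split => //.
  apply: key => [[a b] [c d]|a [b c]] //=.
  by rewrite !mulr0 subr0.
exists (map_mx (@complex.Im R) v), l; split; last first.
  by apply: key => [[a b] [c d]|a [b c]] //=; rewrite mulr0 add0r.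
apply: contraNneq v0 => iv0; apply/eqP/rowP => j.
have /rowP/(_ j) := rv0; have /rowP/(_ j) := iv0; rewrite !mxE.
by case: (P 0 j) => a b /= -> ->.
Qed.

Definition row_norm2 (R : pzRingType) n (v : 'rV[R]_n) := (v *m v^T) 0 0.

Lemma row_norm2E (R : pzRingType) n (v : 'rV[R]_n) : row_norm2 v = \sum_i v 0 i * v 0 i.
Proof. by rewrite /row_norm2 mxE; apply: eq_bigr => i _; rewrite !mxE. Qed.

Lemma row_norm2_gt0 (R : realDomainType) n (v : 'rV[R]_n) : v != 0 -> 0 < row_norm2 v.
Proof.
move=> v0; rewrite row_norm2E lt_def sumr_ge0 ?andbT; last by move=> i _; exact: sqr_ge0.
apply: contraNneq v0 => /eqP; rewrite psumr_eq0; last by move=> i _; exact: sqr_ge0.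
move=> /allP h; apply/eqP/rowP => i; rewrite mxE.
by have := h i (mem_index_enum _); rewrite /= -expr2 sqrf_eq0 => /eqP.
Qed.

(** The witness is the reflection in the hyperplane orthogonal to v - w. *)
Lemma householder (R : realFieldType) n (v w : 'rV[R]_n) : row_norm2 v = row_norm2 w ->
  exists H : 'M[R]_n, [/\ H^T = H, H *m H = 1%:M & w *m H = v].
Proof.
move=> vw; have [->|nvw] := eqVneq v w.
  by exists 1%:M; split; rewrite ?trmx1 ?mulmx1.
have [u uE] : exists u, u = v - w by exists (v - w).
have u0 : u != 0 by rewrite uE subr_eq0.
have su := row_norm2_gt0 u0.
have uu : u *m u^T = (row_norm2 u)%:M by rewrite [LHS]mx11_scalar.
exists (1%:M - (2 / row_norm2 u) *: (u^T *m u)); split.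
- by rewrite linearB /= trmx1 linearZ /= trmx_mul trmxK.
- have MM : u^T *m u *m (u^T *m u) = row_norm2 u *: (u^T *m u).
    by rewrite -mulmxA (mulmxA u) uu mul_scalar_mx -scalemxAr.
  set M := u^T *m u in MM *; clearbody M.
  rewrite mulmxBl mul1mx mulmxBr mulmx1 -scalemxAl -scalemxAr MM.
  apply/matrixP => i j; rewrite !mxE; field.
  by rewrite gt_eqF.
- rewrite mulmxBr mulmx1 -scalemxAr mulmxA.
  have -> : w *m u^T = ((w *m u^T) 0 0)%:M by rewrite [LHS]mx11_scalar.
  rewrite mul_scalar_mx scalerA.
  suff -> : 2 / row_norm2 u * (w *m u^T) 0 0 = -1.
    by rewrite scaleN1r opprK uE addrC subrK.
  have e : row_norm2 u = - 2 * (w *m u^T) 0 0.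
    rewrite /row_norm2 uE linearB /= mulmxBl !mulmxBr !mxE.
    have e2 : \sum_j v 0 j * w^T j 0 = \sum_j w 0 j * v^T j 0.
      by apply: eq_bigr => j _; rewrite !mxE mulrC.
    move: vw; rewrite /row_norm2 !mxE e2 => ->; ring.
  have := su; rewrite e => su'.
  by field; apply/eqP => h; move: su'; rewrite h mulr0 ltxx.
Qed.

(** Deflation: a reflection moves a unit eigenvector to the first coordinate
    axis; symmetry then makes the reflected matrix block diagonal, and the smaller
    block is handled by induction. *)
Theorem symmetric_spectral (R : rcfType) n (A : 'M[R]_n) : A^T = A ->
  exists (U : 'M[R]_n) (l : 'rV[R]_n),
    U *m U^T = 1%:M /\ U *m A = diag_mx l *m U.
Proof.
elim: n A => [|n IH] A symA.
  by exists 1%:M, 0; split; apply/matrixP => -[].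
have [v0 [l [v0n0 v0A]]] := symmetric_eigenvector symA.
have s0 := row_norm2_gt0 v0n0.
pose v := (Num.sqrt (row_norm2 v0))^-1 *: v0.
have vA : v *m A = l *: v by rewrite /v -scalemxAl v0A scalerA mulrC -scalerA.
pose e : 'rV[R]_(1 + n) := row_mx 1%:M 0.
have e1 : row_norm2 e = 1.
  by rewrite /row_norm2 /e tr_row_mx mul_row_col trmx1 mulmx1 trmx0 mulmx0 addr0 mxE.
have v1 : row_norm2 v = row_norm2 e.
  rewrite e1 /row_norm2 /v linearZ /= -scalemxAl -scalemxAr mxE [X in _ * X]mxE.
  rewrite -/(row_norm2 v0).
  have sq := sqr_sqrtr (ltW s0); have := sqrtr_gt0 (row_norm2 v0); rewrite s0 => sp.
  by rewrite -{3}sq; field; rewrite gt_eqF.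
have [H [HT HH eH]] := householder v1.
pose B : 'M[R]_(1 + n) := H *m A *m H.
have symB : B^T = B by rewrite /B !trmx_mul HT symA mulmxA.
have eB : e *m B = l *: e.
  by rewrite /B !mulmxA eH vA -scalemxAl -eH -mulmxA HH mulmx1.
have := submxK B; set b11 := ulsubmx B; set b12 := ursubmx B.
set b21 := dlsubmx B; set b22 := drsubmx B => Bb.
have [b11E b12E] : b11 = l%:M /\ b12 = 0.
  move: eB; rewrite -Bb /e mul_row_block !mul1mx !mul0mx !addr0 scale_row_mx scaler0.
  by move=> /eq_row_mx[-> ->]; rewrite scalemx1.
have b21E : b21 = 0.
  move: symB; rewrite -Bb tr_block_mx => /eq_block_mx[_ h _ _].
  by rewrite -[b21]trmxK h b12E trmx0.
have symb : b22^T = b22.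
  by move: symB; rewrite -Bb tr_block_mx => /eq_block_mx[_ _ _ ->].
have [V [m [VV VB]]] := IH _ symb.
pose W : 'M[R]_(1 + n) := block_mx 1%:M 0 0 V.
have WB : W *m B = diag_mx (row_mx l%:M m) *m W.
  rewrite -Bb diag_mx_row /W !mulmx_block b11E b12E b21E VB.
  rewrite !(mul1mx, mul0mx, mulmx0, mulmx1, addr0, add0r).
  by congr block_mx; apply/matrixP => i j; rewrite !ord1 !mxE.
have WW : W *m W^T = 1%:M.
  rewrite /W tr_block_mx mulmx_block !trmx0 trmx1 VV.
  rewrite !(mul1mx, mul0mx, mulmx0, mulmx1, addr0, add0r).
  by rewrite -scalar_mx_block.
exists (W *m H), (row_mx l%:M m); split.
  by rewrite trmx_mul HT mulmxA -(mulmxA W) HH mulmx1.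
have -> : W *m H *m A = W *m B *m H by rewrite /B !mulmxA -!(mulmxA _ H H) HH mulmx1.
by rewrite WB mulmxA.
Qed.

Lemma diag_form (R : comNzRingType) n (L U : 'M[R]_n) (l v : 'rV[R]_n) :
  U *m U^T = 1%:M -> U *m L = diag_mx l *m U ->
  (v *m L *m v^T) 0 0 = \sum_i l 0 i * ((v *m U^T) 0 i) ^+ 2.
Proof.
move=> UU UL; have UU' := mulmx1C UU.
have -> : L = U^T *m (diag_mx l *m U) by rewrite -UL mulmxA UU' mul1mx.
rewrite !mulmxA -mulmxA -[U *m v^T]trmxK trmx_mul trmxK mul_mx_diag mxE.
by apply: eq_bigr => i _; rewrite !mxE; ring.
Qed.

Lemma psdmx_eig_ge0 (R : realType) n (M U : 'M[R]_n) (l : 'rV[R]_n) :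
  psdmx M -> U *m U^T = 1%:M -> U *m M = diag_mx l *m U -> forall i, 0 <= l 0 i.
Proof.
move=> [_ pM] UU UM i; have := pM (row i U).
rewrite (diag_form _ UU UM) -row_mul UU row1 (bigD1 i) //= mxE !eqxx expr1n mulr1.
by rewrite big1 ?addr0 // => j /negPf ji; rewrite mxE eqxx ji expr0n mulr0.
Qed.

(** The only facts about the output matrix that matter below; the spectral
    theorem supplies the square root whose existence is needed. *)
Lemma sqrtmx_sqr (R : realType) n (M : 'M[R]_n) : psdmx M ->
  (sqrtmx M)^T = sqrtmx M /\ sqrtmx M *m sqrtmx M = M.
Proof.
case=> symM psdM.
suff [S hS] : [set S : 'M[R]_n | psdmx S /\ S *m S = M] !=set0.
  rewrite /sqrtmx; case: xgetP => [T _ /= [[symT _] TT]|/(_ S)] //.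
have [U [l [UU UM]]] := symmetric_spectral symM.
have UU' : U^T *m U = 1%:M by exact: mulmx1C.
have l0 := psdmx_eig_ge0 (conj symM psdM) UU UM.
pose d := map_mx Num.sqrt l.
exists (U^T *m diag_mx d *m U); split.
  split; first by rewrite !trmx_mul trmxK tr_diag_mx mulmxA.
  move=> v; rewrite (_ : _ *m _ = (v *m U^T) *m diag_mx d *m (v *m U^T)^T); last first.
    by rewrite trmx_mul trmxK !mulmxA.
  rewrite mul_mx_diag mxE; apply: sumr_ge0 => k _.
  by rewrite !mxE mulrAC mulr_ge0 ?sqrtr_ge0 // -expr2 sqr_ge0.
rewrite -!mulmxA (mulmxA U) UU mul1mx (mulmxA (diag_mx d)) mulmx_diag.
rewrite (_ : \row_j _ = l); last first.
  by apply/rowP => j; rewrite !mxE -expr2 sqr_sqrtr.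
by rewrite -UM mulmxA UU' mul1mx.
Qed.


(** * The matrix exponential solves its differential equation *)

Section MatrixExponential.
Variables (R : realType) (n : nat) (A : 'M[R]_n).

Let c p i j : R^nat := fun m => (m`!%:R)^-1 * (A ^+ (m + p)) i j.
Let a : R := \sum_i \sum_j `|A i j|.

(** The sum of the absolute values of all entries dominates every row sum, and a
    row sum is what one more factor A can cost. *)
Lemma mx_pow_entry_le m i j : `|(A ^+ m) i j| <= a ^+ m.
Proof.
have a0 : 0 <= a by apply: sumr_ge0 => ? _; apply: sumr_ge0.
elim: m i j => [|m IH] i j.
  by rewrite expr0 mxE; case: (i == j); rewrite ?normr1 ?normr0.
rewrite !exprS mxE (le_trans (ler_norm_sum _ _ _)) //.
apply: (@le_trans _ _ (\sum_k `|A i k| * a ^+ m)).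
  by apply: ler_sum => k _; rewrite normrM ler_wpM2l.
rewrite -mulr_suml ler_wpM2r ?exprn_ge0 // /a [leRHS](bigD1 i) //= lerDl.
by apply: sumr_ge0 => ? _; apply: sumr_ge0.
Qed.

Lemma pseries_exp_cvg p i j t : cvgn (pseries (c p i j) t).
Proof.
apply: normed_cvg; rewrite /normed_series_of.
have a0 : 0 <= a by apply: sumr_ge0 => ? _; apply: sumr_ge0.
apply: (@series_le_cvg _ _ (fun m => a ^+ p * exp_coeff (a * `|t|) m)).
- by move=> m; exact: normr_ge0.
- by move=> m; rewrite mulr_ge0 ?exprn_ge0 // exp_coeff_ge0 // mulr_ge0.
- move=> m; rewrite /c /exp_coeff /= !normrM normrX normfV normr_nat.
  have -> : a ^+ p * ((a * `|t|) ^+ m / m`!%:R) =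
      m`!%:R^-1 * a ^+ (m + p) * `|t| ^+ m by rewrite exprD exprMn; ring.
  rewrite ler_wpM2r ?exprn_ge0 // ler_wpM2l ?invr_ge0 //.
  exact: mx_pow_entry_le.
have -> : series (fun m => a ^+ p * exp_coeff (a * `|t|) m) =
   (fun m => a ^+ p * series (exp_coeff (a * `|t|)) m).
  by apply/funext => m; rewrite /series /= mulr_sumr.
apply: is_cvgMr; exact: is_cvg_series_exp_coeff.
Qed.

Lemma mxscale_exp (t : R) m : (t *: A) ^+ m = t ^+ m *: A ^+ m.
Proof.
elim: m => [|m IH]; first by rewrite !expr0 scale1r.
rewrite !exprS IH; apply/matrixP => i j; rewrite !mxE mulr_sumr.
by apply: eq_bigr => k _; rewrite !mxE; ring.
Qed.

Lemma expmxE t i j : expmx (t *: A) i j = limn (pseries (c 0 i j) t).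
Proof.
rewrite mxE /pseries.
have -> // : (fun m => m`!%:R^-1 * ((t *: A) ^+ m) i j) =
  (fun m => c 0 i j m * t ^+ m).
by apply/funext => m; rewrite /c addn0 mxscale_exp mxE; ring.
Qed.

Lemma expmx0 : expmx (0 *: A) = 1%:M.
Proof.
apply/matrixP => i j; rewrite mxE; apply: lim_near_cst => //.
near=> m; rewrite -[m]prednK; last by near: m.
rewrite /series /= big_nat_recl //= big1 ?addr0.
  by rewrite mxscale_exp !expr0 scale1r fact0 invr1 mul1r.
by move=> k _; rewrite mxscale_exp exprS mul0r scale0r mxE mulr0.
Unshelve. all: by end_near. Qed.

Lemma pseries_diffs_exp p i j : pseries_diffs (c p i j) = c p.+1 i j.
Proof.
apply/funext => m; rewrite /pseries_diffs /c addSnnS factS natrM invfM.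
by rewrite !mulrA divff ?mul1r // pnatr_eq0.
Qed.

(** Differentiating the power series of an entry term by term shifts the power
    of A by one, because (m + 1) / (m + 1)! = 1 / m!. *)
Lemma is_derive_expmx t i j :
  is_derive t (1 : R) (fun t => expmx (t *: A) i j)
    ((A *m expmx (t *: A)) i j).
Proof.
have -> : (fun t => expmx (t *: A) i j) = (fun t => limn (pseries (c 0 i j) t)).
  by apply/funext => s; rewrite expmxE.
have -> : (A *m expmx (t *: A)) i j = limn (pseries (pseries_diffs (c 0 i j)) t).
  rewrite pseries_diffs_exp mxE; apply/esym/cvg_lim => //.
  have -> : pseries (c 1 i j) t =
      (fun m => \sum_k A i k * pseries (c 0 k j) t m).
    apply/funext => m; rewrite /pseries /series /=.
    under [RHS]eq_bigr do rewrite mulr_sumr.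
    rewrite exchange_big /=; apply: eq_bigr => l _.
    rewrite /c addn1 addn0 exprS mxE mulr_sumr mulr_suml.
    by apply: eq_bigr => k _; ring.
  apply: cvg_big; first exact: add_continuous.
  move=> k _; rewrite expmxE; apply: cvgMr.
  exact: pseries_exp_cvg.
apply: (@pseries_snd_diffs _ _ (`|t| + 1)); rewrite ?pseries_diffs_exp;
  try exact: pseries_exp_cvg.
by rewrite [ltRHS]ger0_norm// ltrDl.
Qed.

End MatrixExponential.

(** * Exact cost of one closed-loop mode *)

Section PointwiseDerivatives.
Variables (R : realType) (t : R).

Lemma is_derive_mul (f g : R -> R) df dg :
  is_derive t 1 f df -> is_derive t 1 g dg ->
  is_derive t 1 (fun s => f s * g s) (f t * dg + g t * df).
Proof. by move=> hf hg; apply: is_deriveM. Qed.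

Lemma is_derive_add (f g : R -> R) df dg :
  is_derive t 1 f df -> is_derive t 1 g dg ->
  is_derive t 1 (fun s => f s + g s) (df + dg).
Proof. by move=> hf hg; apply: is_deriveD. Qed.

Lemma is_derive_scale (f : R -> R) c df :
  is_derive t 1 f df -> is_derive t 1 (fun s => c * f s) (c * df).
Proof. by move=> hf; apply: is_deriveZ. Qed.

Lemma is_derive_bigsum n (f : 'I_n -> R -> R) (df : 'I_n -> R) :
  (forall i, is_derive t 1 (f i) (df i)) ->
  is_derive t 1 (fun s => \sum_(i < n) f i s) (\sum_(i < n) df i).
Proof.
move=> hf; rewrite (_ : (fun s => _) = \sum_(i < n) f i).
  exact: is_derive_sum.
by apply/funext => s; rewrite fct_sumE.
Qed.

End PointwiseDerivatives.

Lemma nonincreasing_of_derive (R : realType) (f df : R -> R) :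
  (forall t : R, is_derive t (1 : R) f (df t)) -> (forall t, 0 <= t -> df t <= 0) ->
  forall t, 0 <= t -> f t <= f 0.
Proof.
move=> hf hdf t t0; apply: (@ler0_derive1_nincry _ f 0) => //.
- by move=> x; rewrite in_itv /= andbT => /ltW x0; rewrite derive1E derive_val hdf.
- apply: continuous_subspaceT => x.
  exact/differentiable_continuous/derivable1_diffP/ex_derive.
Qed.

(** Quadratic forms in the three state variables of a mode; the off-diagonal
    coefficients x2, x3 and x5 are those of the monomials, so they are twice the
    entries of the symmetric matrix. *)
Definition qform (R : pzRingType) (x1 x2 x3 x4 x5 x6 u v w : R) : R :=
  x1 * (u * u) + x2 * (u * v) + x3 * (u * w) +
  x4 * (v * v) + x5 * (v * w) + x6 * (w * w).

Lemma is_derive_qform (R : realType) (x1 x2 x3 x4 x5 x6 : R)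
    (u v w : R -> R) (t du dv dw : R) :
  is_derive t 1 u du -> is_derive t 1 v dv -> is_derive t 1 w dw ->
  is_derive t 1 (fun s => qform x1 x2 x3 x4 x5 x6 (u s) (v s) (w s))
   (2 * x1 * u t * du + x2 * (u t * dv + v t * du) +
    x3 * (u t * dw + w t * du) + 2 * x4 * v t * dv +
    x5 * (v t * dw + w t * dv) + 2 * x6 * w t * dw).
Proof.
move=> hu hv hw; apply: is_derive_eq; rewrite /GRing.scale /=; ring.
Qed.

Lemma qform_le (R : realFieldType) (x1 x2 x3 x4 x5 x6 u v w : R) :
  `|qform x1 x2 x3 x4 x5 x6 u v w| <=
  (`|x1| + `|x2| + `|x3| + `|x4| + `|x5| + `|x6|) * (u ^+ 2 + v ^+ 2 + w ^+ 2).
Proof.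
have h (x y z s : R) : `|y * z| <= s -> `|x * (y * z)| <= `|x| * s.
  by move=> yz; rewrite normrM ler_wpM2l.
rewrite !mulrDl /qform.
do 5 (apply: le_trans (ler_normD _ _) _; apply: lerD; last by
  apply: h; rewrite ler_norml; nra).
by apply: h; rewrite ler_norml; nra.
Qed.

Section Mode.
Variables (R : realType) (a g q tau : R) (th om Om : R -> R).
Hypotheses (a0 : 0 < a) (g0 : 0 < g) (q0 : 0 < q) (tau0 : 0 < tau).
Hypothesis dth : forall t : R, is_derive t (1 : R) th (om t).
Hypothesis dom : forall t : R,
  is_derive t (1 : R) om (tau^-1 * (- a * th t - om t + Om t)).
Hypothesis dOm : forall t : R, is_derive t (1 : R) Om (q^-1 * (- om t - g * Om t)).

Let E t := qform a 0 0 tau 0 q (th t) (om t) (Om t).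

(** The dissipation does not involve theta, so the stored energy alone is not a
    strict Lyapunov function. *)
Lemma is_derive_mode_energy (t : R) :
  is_derive t 1 E (- 2 * (om t ^+ 2 + g * Om t ^+ 2)).
Proof.
apply: (is_derive_eq (is_derive_qform _ _ _ _ _ _ (dth t) (dom t) (dOm t))).
by field; rewrite !gt_eqF.
Qed.

(** A large multiple of the energy, plus the cross term 2 tau theta omega +
    theta^2, is a nonnegative V with V' <= - E. As E does not increase, V + t E does
    not increase either, which bounds t E(t) by V(0). Decay like 1 / t is all that
    is needed to make the quadratic form below vanish at infinity. *)
Lemma mode_energy_decay : exists M : R, forall t, 0 < t -> E t <= M / t.
Proof.
(* K - 3/2 tau and 2 K g - 1/a - q must be nonnegative to dominate the cross
   terms in the derivative of V. *)
pose K := 2 * tau + (q + a^-1) / (2 * g).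
have ai : 0 < a^-1 by rewrite invr_gt0.
have Kt : 2 * tau <= K.
  by rewrite lerDl divr_ge0 ?addr_ge0 ?mulr_ge0 // ltW.
have Kg : 2 * K * g = 4 * tau * g + q + a^-1.
  by rewrite /K; field; rewrite !gt_eqF.
clearbody K.
pose V t := qform (K * a + 1) (2 * tau) 0 (K * tau) 0 (K * q) (th t) (om t) (Om t).
pose G t := V t + t * E t.
have V0 t : 0 <= V t.
  have -> : V t = (th t + tau * om t) ^+ 2 + K * a * th t ^+ 2
     + tau * (K - tau) * om t ^+ 2 + K * q * Om t ^+ 2 by rewrite /V /qform; ring.
  have K0 : 0 <= K by apply: le_trans Kt; rewrite mulr_ge0 // ltW.
  have K1 : 0 <= K - tau by lra.
  by rewrite !addr_ge0 ?sqr_ge0 // mulr_ge0 ?sqr_ge0 // mulr_ge0 // ltW.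
have dG (t : R) : is_derive t 1 G
   (2 * tau * om t ^+ 2 - 2 * a * th t ^+ 2 + 2 * th t * Om t
     - 2 * K * (om t ^+ 2 + g * Om t ^+ 2)
    + (t * (- 2 * (om t ^+ 2 + g * Om t ^+ 2)) + E t)).
  apply: is_derive_add.
    apply: (is_derive_eq (is_derive_qform _ _ _ _ _ _ (dth t) (dom t) (dOm t))).
    by field; rewrite !gt_eqF.
  apply: (is_derive_eq (is_derive_mul (is_derive_id _ _) (is_derive_mode_energy t))).
  by rewrite mulr1.
exists (V 0) => t t0; rewrite ler_pdivlMr // mulrC.
suff : G t <= G 0 by rewrite /G mul0r addr0; have := V0 t; lra.
apply: (nonincreasing_of_derive dG) (ltW t0) => s s0.
have os := sqr_ge0 (om s); have ths := sqr_ge0 (th s); have Os := sqr_ge0 (Om s).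
have young : 2 * th s * Om s <= a * th s ^+ 2 + a^-1 * Om s ^+ 2.
  rewrite -subr_ge0.
  have -> : a * th s ^+ 2 + a^-1 * Om s ^+ 2 - 2 * th s * Om s =
     a^-1 * (a * th s - Om s) ^+ 2 by field; rewrite gt_eqF.
  by rewrite mulr_ge0 ?sqr_ge0 // ltW.
have h1 : 0 <= s * (om s ^+ 2 + g * Om s ^+ 2).
  by rewrite mulr_ge0 // addr_ge0 // mulr_ge0 ?sqr_ge0 // ltW.
have h2 : 2 * K * (om s ^+ 2 + g * Om s ^+ 2) =
    2 * K * om s ^+ 2 + (4 * tau * g + q + a^-1) * Om s ^+ 2.
  by rewrite -Kg; ring.
have h3 : 0 <= (K - 2 * tau) * om s ^+ 2 by rewrite mulr_ge0 ?sqr_ge0 // subr_ge0.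
have h4 : 0 <= tau * g * Om s ^+ 2 by rewrite mulr_ge0 ?sqr_ge0 // mulr_ge0 // ltW.
have h5 : 0 <= tau * om s ^+ 2 by rewrite mulr_ge0 ?sqr_ge0 // ltW.
rewrite h2 /E /qform; lra.
Qed.

Let D := q + a * q ^+ 2 + tau * g + q * g + tau * g ^+ 2.

(** With g = gamma lambda and a = k lambda, the denominator D is
    (q + tau g) (1 + phi), where phi is the function
    (a q^2 + q g + tau g^2) / (q + tau g). So this coefficient of omega^2 is
    tau^2 / (2 a) times 1 / (1 + 1 / phi). *)
Definition lyap_om := tau ^+ 2 / (2 * a) * (1 - (q + tau * g) / D).
(** Coefficient of Omega^2, that is q^2 / (2 a g) times 1 / (1 + phi). *)
Definition lyap_Om := q ^+ 2 * (q + tau * g) / (2 * a * g * D).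
Let x5 := tau * g * lyap_Om / q.
Let x3 := q / (2 * a * g) - a * lyap_Om.
Let x1 := (2 * a)^-1 + x3 / q + lyap_om * a / tau.

(** The quadratic form Q solving the Lyapunov equation Q' = - theta^2. The
    theta^2 part of the equation gives the coefficient of theta omega; the other
    five parts express all remaining coefficients through that of Omega^2, and
    determine it. *)
Definition mode_cost := qform x1 (tau / a) (2 * x3) lyap_om (2 * x5) lyap_Om.

(** Since Q' = - theta^2 and Q tends to 0 along the trajectory, the energy of
    theta is the initial value of Q. *)
Lemma mode_loss :
  (\int[lebesgue_measure]_(t in `[0%R, +oo[) ((th t) ^+ 2)%:E =
   (mode_cost (th 0) (om 0) (Om 0))%:E)%E.
Proof.
rewrite /mode_cost; pose Q t := qform x1 (tau / a) (2 * x3) lyap_om (2 * x5) lyap_Om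
   (th t) (om t) (Om t).
have D0 : 0 < D.
  by rewrite /D !addr_gt0 // ?mulr_gt0 ?exprn_gt0.
have dQ (t : R) : is_derive t 1 Q (- (th t ^+ 2)).
  apply: (is_derive_eq (is_derive_qform _ _ _ _ _ _ (dth t) (dom t) (dOm t))).
  rewrite /x1 /x3 /x5 /lyap_om /lyap_Om; move: D0; rewrite /D => D0.
  by field; rewrite !gt_eqF.
have [M EM] := mode_energy_decay.
have Qbound : exists C : R, forall t, 0 < t -> `|Q t| <= C * t^-1.
  set X := `|x1| + `|tau / a| + `|2 * x3| + `|lyap_om| + `|2 * x5| + `|lyap_Om|.
  exists (X * (a^-1 + tau^-1 + q^-1) * M) => t t0.
  apply: le_trans (qform_le _ _ _ _ _ _ _ _ _) _; rewrite -/X -!mulrA.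
  have X0 : 0 <= X by rewrite !addr_ge0.
  rewrite ler_wpM2l //; apply: le_trans (ler_wpM2l _ (EM _ t0)); last first.
    by rewrite !addr_ge0 // invr_ge0 ltW.
  have p1 : 0 <= a * th t ^+ 2 by rewrite mulr_ge0 ?sqr_ge0 // ltW.
  have p2 : 0 <= tau * om t ^+ 2 by rewrite mulr_ge0 ?sqr_ge0 // ltW.
  have p3 : 0 <= q * Om t ^+ 2 by rewrite mulr_ge0 ?sqr_ge0 // ltW.
  rewrite !mulrDl; apply: lerD; first apply: lerD;
    rewrite [leRHS]mulrC ler_pdivlMr // /E /qform; lra.
have Qlim : Q x @[x --> +oo%R] --> 0.
  have [C QC] := Qbound.
  apply/cvgrPdist_le => e e0.
  exists (Num.max 0 (C / e)); split; first exact: num_real.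
  move=> x; rewrite gt_max => /andP[x0 xC].
  rewrite sub0r normrN (le_trans (QC _ x0)) // ler_pdivrMr // mulrC -ler_pdivrMr //.
  exact: ltW.
have cont (f : R -> R) df :
    (forall t, is_derive (t : R) (1 : R) f (df t)) -> continuous f.
  by move=> hf x; apply/differentiable_continuous/derivable1_diffP; apply: ex_derive.
have dNQ (t : R) : is_derive t 1 (- Q) (th t ^+ 2).
  by rewrite -[th t ^+ 2]opprK; apply: is_deriveN.
rewrite (@ge0_continuous_FTC2y _ _ (- Q) 0 0).
- by rewrite -EFinB /= sub0r opprK.
- by move=> x _; exact: sqr_ge0.
- apply: continuous_subspaceT => x; by apply: continuousM; exact: (cont _ _ dth).
- by rewrite -oppr0; apply: cvgN.
- by move=> x _; apply: ex_derive.
- apply: cvg_at_right_filter; exact: (cont _ _ dNQ).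
- by move=> x _; rewrite derive1E derive_val.
Qed.

End Mode.

(** * Losses as sums over the Laplacian spectrum *)

Lemma is_derive_mulmxl (R : realType) m n p (M : 'M[R]_(m, n))
    (X : R -> 'M[R]_(n, p)) (dX : 'M[R]_(n, p)) (t : R) :
  (forall i j, is_derive t (1 : R) (fun s => X s i j) (dX i j)) ->
  forall i j, is_derive t (1 : R) (fun s => (M *m X s) i j) ((M *m dX) i j).
Proof.
move=> hX i j.
rewrite (_ : (fun s => _) = fun s => \sum_k M i k * X s k j); last first.
  by apply/funext => s; rewrite mxE.
by rewrite mxE; apply: is_derive_bigsum => k; apply: is_derive_scale.
Qed.

Lemma is_derive_impulse (R : realType) m p (A : 'M[R]_m) (B : 'M[R]_(m, p)) (t : R) i j :
  is_derive t (1 : R) (fun s => (expmx (s *: A) *m B) i j)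
    ((A *m (expmx (t *: A) *m B)) i j).
Proof.
rewrite (_ : (fun s => _) = fun s => \sum_k B k j * expmx (s *: A) i k); last first.
  by apply/funext => s; rewrite mxE; apply: eq_bigr => k _; rewrite mulrC.
rewrite mulmxA mxE; under eq_bigr do rewrite mulrC.
by apply: is_derive_bigsum => k; apply: is_derive_scale; exact: is_derive_expmx.
Qed.

Lemma integral_sum_sqr (R : realType) (I : Type) (s : seq I)
    (c : I -> R) (f : I -> R -> R) :
  (forall i, 0 <= c i) -> (forall i, continuous (f i)) ->
  (\int[lebesgue_measure]_(t in `[0%R, +oo[) (\sum_(i <- s) c i * f i t ^+ 2)%:E =
   \sum_(i <- s) (c i)%:E * \int[lebesgue_measure]_(t in `[0%R, +oo[) (f i t ^+ 2)%:E)%E.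
Proof.
move=> c0 cf.
have mf i : measurable_fun (`[0%R, +oo[%classic : set R)
    (EFin \o (fun t : R => f i t ^+ 2)).
  apply/measurable_EFinP/measurable_funX; apply: measurable_funTS.
  exact: continuous_measurable_fun.
under eq_integral do rewrite -sumEFin.
rewrite ge0_integral_sum //.
- apply: eq_bigr => i _; rewrite -ge0_integralZl_EFin //.
    by move=> x _; rewrite lee_fin sqr_ge0.
  exact: mf.
- move=> i; apply/measurable_EFinP; apply: measurable_funM => //.
  by apply/measurable_EFinP; apply: mf.
- by move=> i x _; rewrite lee_fin mulr_ge0 ?sqr_ge0.
Qed.

Section LossFormula.
Variables (R : realType) (n : nat) (L U : 'M[R]_n) (l : 'rV[R]_n).
Variables (alpha gamma k q tau : R).
Hypotheses (alpha0 : 0 < alpha) (gamma0 : 0 < gamma) (k0 : 0 < k).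
Hypotheses (q0 : 0 < q) (tau0 : 0 < tau).
Hypotheses (psdL : psdmx L) (UU : U *m U^T = 1%:M) (UL : U *m L = diag_mx l *m U).
Hypothesis (l0 : forall i, 0 <= l 0 i).

Let A := dapiA L gamma k q tau.
Let C := dapiC L alpha.

Variables B1 B2 B3 : 'M[R]_n.
Let B : 'M[R]_(n + (n + n), n) := col_mx B1 (col_mx B2 B3).

Let X (t : R) := expmx (t *: A) *m B.
Let th t := U *m usubmx (X t).
Let om t := U *m usubmx (dsubmx (X t)).
Let Om t := U *m dsubmx (dsubmx (X t)).

Let X_eq t : X t =
  col_mx (usubmx (X t)) (col_mx (usubmx (dsubmx (X t))) (dsubmx (dsubmx (X t)))).
Proof. by rewrite !vsubmxK. Qed.

Let AX t : A *m X t = col_mx (usubmx (dsubmx (X t)))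
  (col_mx (- (k / tau) *: (L *m usubmx (X t)) - tau^-1 *: usubmx (dsubmx (X t))
           + tau^-1 *: dsubmx (dsubmx (X t)))
          (- q^-1 *: usubmx (dsubmx (X t))
           - (gamma / q) *: (L *m dsubmx (dsubmx (X t))))).
Proof.
rewrite {1}X_eq /A /dapiA mul_block_col mul0mx add0r mul_row_col mul1mx mul0mx addr0.
rewrite mul_col_mx mul0mx mul_block_col add_col_mx add0r.
by rewrite !mul_scalar_mx -!scalemxAl !scaleNr addrA.
Qed.

Let UE (M : 'M[R]_n) : U *m (L *m M) = diag_mx l *m (U *m M).
Proof. by rewrite !mulmxA UL. Qed.

Let dth i j (t : R) : is_derive t (1 : R) (fun s => th s i j) (om t i j).
Proof.
apply: is_derive_mulmxl => {}i {}j.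
rewrite (_ : usubmx _ = usubmx (A *m X t)); last by rewrite AX col_mxKu.
under eq_fun do rewrite mxE; rewrite mxE; exact: is_derive_impulse.
Qed.

Let dom i j (t : R) : is_derive t (1 : R) (fun s => om s i j)
  (tau^-1 * (- (k * l 0 i) * th t i j - om t i j + Om t i j)).
Proof.
have -> : tau^-1 * (- (k * l 0 i) * th t i j - om t i j + Om t i j) =
    (U *m usubmx (dsubmx (A *m X t))) i j.
  rewrite AX col_mxKd col_mxKu !mulmxDr mulmxN -!scalemxAr.
  rewrite UE -/(th t) -/(om t) -/(Om t).
  by move: (th t) (om t) (Om t) => a b c; rewrite mul_diag_mx !mxE; ring.
apply: is_derive_mulmxl => {}i {}j.
under eq_fun do rewrite 2!mxE; rewrite 2!mxE; exact: is_derive_impulse.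
Qed.

Let dOm i j (t : R) : is_derive t (1 : R) (fun s => Om s i j)
  (q^-1 * (- om t i j - gamma * l 0 i * Om t i j)).
Proof.
have -> : q^-1 * (- om t i j - gamma * l 0 i * Om t i j) =
    (U *m dsubmx (dsubmx (A *m X t))) i j.
  rewrite AX !col_mxKd !mulmxDr mulmxN -!scalemxAr.
  rewrite UE -/(om t) -/(Om t).
  by move: (om t) (Om t) => b c; rewrite mul_diag_mx !mxE; ring.
apply: is_derive_mulmxl => {}i {}j.
under eq_fun do rewrite 2!mxE; rewrite 2!mxE; exact: is_derive_impulse.
Qed.

Let output_energy t : let h := C *m expmx (t *: A) *m B in
  \tr (h^T *m h) = \sum_(p : 'I_n * 'I_n) alpha * l 0 p.1 * th t p.1 p.2 ^+ 2.
Proof.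
move=> h; have psdaL : psdmx (alpha *: L).
  case: psdL => symL psL; split; first by rewrite linearZ /= symL.
  by move=> v; rewrite -scalemxAr -scalemxAl mxE mulr_ge0 // ltW.
have [symS SS] := sqrtmx_sqr psdaL.
have -> : h = sqrtmx (alpha *: L) *m usubmx (X t).
  by rewrite /h -mulmxA -/(X t) [X t in LHS]X_eq /C mul_row_col mul0mx addr0.
rewrite trmx_mul symS mulmxA -(mulmxA _^T) SS.
have -> : (usubmx (X t))^T *m (alpha *: L) *m usubmx (X t) =
   alpha *: ((th t)^T *m (diag_mx l *m th t)).
  rewrite /th -UE trmx_mul -[in RHS]mulmxA (mulmxA U^T) (mulmx1C UU) mul1mx.
  by rewrite -mulmxA -scalemxAl -scalemxAr.
rewrite linearZ /= mxtrace_mulC mulr_sumr.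
rewrite -(pair_bigA _ (fun i j => alpha * l 0 i * th t i j ^+ 2)) /=.
apply: eq_bigr => i _; rewrite mxE mulr_sumr; apply: eq_bigr => j _.
by rewrite mul_diag_mx !mxE; ring.
Qed.

(** Left multiplication by U decouples the columns of the impulse response:
    the rows of U are eigenvectors of L, so row i of the transformed state follows
    the single mode with eigenvalue l_i. The zero modes are weighted by l_i = 0 in
    the output, so their lack of decay does no harm. *)
Lemma dapi_loss_modes :
  H2norm_sq A B C = (\sum_i \sum_j if 0 < l 0 i then
     alpha * l 0 i * mode_cost (k * l 0 i) (gamma * l 0 i) q tau
       ((U *m B1) i j) ((U *m B2) i j) ((U *m B3) i j) else 0)%:E.
Proof.
rewrite /H2norm_sq; under eq_integral do rewrite output_energy.
rewrite integral_sum_sqr; last 2 first.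
- by move=> [i j] /=; rewrite mulr_ge0 // ltW.
- move=> [i j] x /=; apply/differentiable_continuous/derivable1_diffP.
  exact: ex_derive.
rewrite pair_bigA /= -sumEFin; apply: eq_bigr => -[i j] _ /=.
have X0 : X 0 = B by rewrite /X expmx0 mul1mx.
case: ltP => li; last first.
  by rewrite (_ : l 0 i = 0) ?mulr0 ?mul0e //; apply/eqP; rewrite eq_le li l0.
rewrite (mode_loss (mulr_gt0 k0 li) (mulr_gt0 gamma0 li) q0 tau0
  (dth i j) (dom i j) (dOm i j)).
by rewrite -EFinM /th /om /Om X0 /B !(col_mxKu, col_mxKd).
Qed.

End LossFormula.

Lemma mode_cost_om (R : realType) (a g q tau v : R) :
  mode_cost a g q tau 0 v 0 = lyap_om a g q tau * v ^+ 2.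
Proof. rewrite /mode_cost /qform; ring. Qed.

Lemma mode_cost_Om (R : realType) (a g q tau v : R) :
  mode_cost a g q tau 0 0 v = lyap_Om a g q tau * v ^+ 2.
Proof. rewrite /mode_cost /qform; ring. Qed.

Section LossBounds.
Variables (R : realType) (n : nat) (L U : 'M[R]_n) (l : 'rV[R]_n).
Variables (alpha gamma k q tau eps : R).
Hypotheses (alpha0 : 0 < alpha) (gamma0 : 0 < gamma) (k0 : 0 < k).
Hypotheses (q0 : 0 < q) (tau0 : 0 < tau).
Hypotheses (psdL : psdmx L) (UU : U *m U^T = 1%:M) (UL : U *m L = diag_mx l *m U).
Hypothesis (l0 : forall i, 0 <= l 0 i).

Lemma orthogonal_row_sqr i : \sum_j U i j ^+ 2 = 1.
Proof.
have /matrixP/(_ i i) := UU; rewrite !mxE eqxx mulr1n => <-.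
by apply: eq_bigr => j _; rewrite mxE expr2.
Qed.

(** Power noise starts every mode at rest except for omega; the rows of U have
    norm 1, so summing over the noise channels leaves one term per mode. *)
Lemma dapi_loss_P_modes : dapi_loss_P L alpha gamma k q tau =
  (\sum_(i | 0 < l 0 i)
     alpha * l 0 i * (lyap_om (k * l 0 i) (gamma * l 0 i) q tau / tau ^+ 2))%:E.
Proof.
rewrite /dapi_loss_P /dapiB_P (dapi_loss_modes alpha0 gamma0 k0 q0 tau0 psdL UU UL l0).
congr EFin; rewrite [RHS]big_mkcond /=; apply: eq_bigr => i _.
case: ifP => // _; last by rewrite big1.
rewrite -[RHS]mulr1 -(orthogonal_row_sqr i) mulr_sumr; apply: eq_bigr => j _.
by rewrite mulmx0 mul_mx_scalar !mxE mode_cost_om; field; rewrite gt_eqF.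
Qed.

Lemma dapi_loss_eta_modes : dapi_loss_eta L alpha gamma k q tau eps =
  (\sum_(i | 0 < l 0 i)
     alpha * l 0 i * (lyap_Om (k * l 0 i) (gamma * l 0 i) q tau * (eps / q) ^+ 2))%:E.
Proof.
rewrite /dapi_loss_eta /dapiB_eta.
rewrite (dapi_loss_modes alpha0 gamma0 k0 q0 tau0 psdL UU UL l0).
congr EFin; rewrite [RHS]big_mkcond /=; apply: eq_bigr => i _.
case: ifP => // _; last by rewrite big1.
rewrite -[RHS]mulr1 -(orthogonal_row_sqr i) mulr_sumr; apply: eq_bigr => j _.
by rewrite mulmx0 mul_mx_scalar !mxE mode_cost_Om; ring.
Qed.

(** Each term is alpha / (2 k) times 1 / (1 + 1 / phi), a factor below 1. *)
Lemma dapi_loss_P_le : (dapi_loss_P L alpha gamma k q tau <= (n%:R * (alpha / (2 * k)))%:E)%E.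
Proof.
rewrite dapi_loss_P_modes lee_fin.
have c0 : 0 <= alpha / (2 * k) by rewrite divr_ge0 ?mulr_ge0 // ltW.
apply: (@le_trans _ _ (\sum_(i < n) alpha / (2 * k))); last first.
  by rewrite sumr_const card_ord [leRHS]mulr_natl.
rewrite big_mkcond; apply: ler_sum => i _; case: ltP => // li.
rewrite /lyap_om; set D := q + _ + _ + _ + _.
have kl := mulr_gt0 k0 li; have gl := mulr_gt0 gamma0 li.
have D0 : 0 < D by rewrite /D !addr_gt0 // ?mulr_gt0 ?exprn_gt0.
have -> : alpha * l 0 i * (tau ^+ 2 / (2 * (k * l 0 i)) *
   (1 - (q + tau * (gamma * l 0 i)) / D) / tau ^+ 2) =
   alpha / (2 * k) * (1 - (q + tau * (gamma * l 0 i)) / D).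
  by field; rewrite !gt_eqF.
rewrite ler_piMr // gerBl divr_ge0 // ?addr_ge0 ?mulr_ge0 // ltW //.
Qed.

(** The middle term is eps^2 alpha / (2 k gamma x) divided by 1 + phi, and
    0 <= phi <= (gamma + k q) x. *)
Lemma eta_mode_bounds (Lam x : R) : 0 < x -> x <= Lam ->
  eps ^+ 2 * (alpha / (2 * k * gamma) / (1 + (gamma + k * q) * Lam)) * x^-1 <=
    alpha * x * (lyap_Om (k * x) (gamma * x) q tau * (eps / q) ^+ 2) <=
  eps ^+ 2 * (alpha / (2 * k * gamma)) * x^-1.
Proof.
move=> x0 xL; rewrite /lyap_Om; set D := q + _ + _ + _ + _.
have kx := mulr_gt0 k0 x0; have gx := mulr_gt0 gamma0 x0.
have D0 : 0 < D by rewrite /D !addr_gt0 // ?mulr_gt0 ?exprn_gt0.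
set g := gamma * x in D D0 gx *.
have -> : alpha * x * (q ^+ 2 * (q + tau * g) / (2 * (k * x) * g * D) * (eps / q) ^+ 2) =
    eps ^+ 2 * (alpha / (2 * k * gamma)) * x^-1 * ((q + tau * g) / D).
  by rewrite /g; field; rewrite !gt_eqF.
have C0 : 0 <= eps ^+ 2 * (alpha / (2 * k * gamma)) * x^-1.
  rewrite mulr_ge0 ?invr_ge0 ?(ltW x0) // mulr_ge0 ?sqr_ge0 //.
  by rewrite divr_ge0 ?mulr_ge0 // ltW.
have c0 : 0 < gamma + k * q by rewrite addr_gt0 // mulr_gt0.
have qg0 : 0 < q + tau * g by rewrite addr_gt0 // mulr_gt0.
have B0 : 0 < 1 + (gamma + k * q) * Lam.
  by rewrite addr_gt0 // mulr_gt0 // (lt_le_trans x0).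
apply/andP; split; last first.
  rewrite ler_piMr // ler_pdivrMr // mul1r /D.
  have : 0 <= k * x * q ^+ 2 by rewrite !mulr_ge0 ?sqr_ge0 // ltW.
  have : 0 <= tau * g ^+ 2 by rewrite !mulr_ge0 ?sqr_ge0 // ltW.
  have : 0 <= q * g by rewrite !mulr_ge0 // ltW.
  lra.
rewrite mulrA [leLHS]mulrAC ler_wpM2l // ler_pdivlMr // mulrC ler_pdivrMr //.
apply: (@le_trans _ _ ((q + tau * g) * (1 + (gamma + k * q) * x))).
  have : 0 <= tau * g * (k * q * x) by rewrite !mulr_ge0 // ltW.
  by rewrite /D /g; lra.
by rewrite ler_pM2l // lerD2l ler_pM2l.
Qed.

Lemma dapi_loss_eta_bounds (Lam : R) : (forall i, l 0 i <= Lam) ->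
  exists S : R, [/\ dapi_loss_eta L alpha gamma k q tau eps = S%:E,
   eps ^+ 2 * (alpha / (2 * k * gamma) / (1 + (gamma + k * q) * Lam)) *
     (\sum_(i | 0 < l 0 i) (l 0 i)^-1) <= S &
   S <= eps ^+ 2 * (alpha / (2 * k * gamma)) * (\sum_(i | 0 < l 0 i) (l 0 i)^-1)].
Proof.
move=> lL; rewrite dapi_loss_eta_modes; eexists; split; first reflexivity.
all: by rewrite mulr_sumr; apply: ler_sum => i li; have /andP[] := eta_mode_bounds li (lL i).
Qed.

End LossBounds.

(** * Comparing the inverse spectra of two Laplacians *)

Section SpectralCompare.
Variables (R : realFieldType) (n : nat).
Variables (L U L0 W : 'M[R]_n) (l mu : 'rV[R]_n) (i0 : 'I_n) (c1 c2 : R).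
Hypotheses (UU : U *m U^T = 1%:M) (UL : U *m L = diag_mx l *m U).
Hypotheses (WW : W *m W^T = 1%:M) (WL : W *m L0 = diag_mx mu *m W).
Hypothesis l0 : forall i, 0 <= l 0 i.
Hypotheses (mu0 : mu 0 i0 = 0) (mu_gt0 : forall k, k != i0 -> 0 < mu 0 k).
Hypotheses (c1_gt0 : 0 < c1) (c2_gt0 : 0 < c2).
Hypothesis L0_le : forall v : 'rV[R]_n, (v *m L0 *m v^T) 0 0 <= c1 * (v *m L *m v^T) 0 0.
Hypothesis L_le : forall v : 'rV[R]_n, (v *m L *m v^T) 0 0 <= c2 * (v *m L0 *m v^T) 0 0.

Let A := U *m W^T.

Let rowUU i : row i U *m U^T = delta_mx 0 i.
Proof. by rewrite -row_mul UU row1. Qed.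

Let rowWW k : row k W *m W^T = delta_mx 0 k.
Proof. by rewrite -row_mul WW row1. Qed.

Let form_rowU i : (row i U *m L *m (row i U)^T) 0 0 = l 0 i.
Proof.
rewrite (diag_form _ UU UL) rowUU (bigD1 i) //= mxE !eqxx expr1n mulr1 big1 ?addr0 //.
by move=> j /negPf ji; rewrite mxE eqxx ji expr0n mulr0.
Qed.

Let form_rowW k : (row k W *m L0 *m (row k W)^T) 0 0 = mu 0 k.
Proof.
rewrite (diag_form _ WW WL) rowWW (bigD1 k) //= mxE !eqxx expr1n mulr1 big1 ?addr0 //.
by move=> j /negPf ji; rewrite mxE eqxx ji expr0n mulr0.
Qed.

Let mu_ge0 k : 0 <= mu 0 k.
Proof. by case: (eqVneq k i0) => [->|/mu_gt0/ltW]; rewrite ?mu0. Qed.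

Let form0_ge k (v : 'rV[R]_n) : mu 0 k * (v *m W^T) 0 k ^+ 2 <= (v *m L0 *m v^T) 0 0.
Proof.
rewrite (diag_form _ WW WL) (bigD1 k) //= lerDl sumr_ge0 // => j _.
by rewrite mulr_ge0 ?sqr_ge0.
Qed.

Let AE i k : (row i U *m W^T) 0 k = A i k.
Proof. by rewrite -row_mul mxE. Qed.

Let AE' i k : (row k W *m U^T) 0 i = A i k.
Proof. by rewrite -row_mul mxE /A -[U *m W^T]trmxK trmx_mul trmxK [RHS]mxE. Qed.

Let AAT : A *m A^T = 1%:M.
Proof. by rewrite /A trmx_mul trmxK mulmxA -(mulmxA U) (mulmx1C WW) mulmx1. Qed.

Let sumA_row i : \sum_k A i k ^+ 2 = 1.
Proof.
have /matrixP/(_ i i) := AAT; rewrite mxE [RHS]mxE eqxx mulr1n => <-.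
by apply: eq_bigr => k _; rewrite [A^T _ _]mxE.
Qed.

Let sumA_col k : \sum_i A i k ^+ 2 = 1.
Proof.
have /matrixP/(_ k k) := mulmx1C AAT; rewrite mxE [RHS]mxE eqxx mulr1n => <-.
by apply: eq_bigr => i _; rewrite [A^T _ _]mxE.
Qed.

(** The kernel vector w_i0 of L0 has zero energy for L as well, so it is
    orthogonal to every eigenvector with a positive eigenvalue. *)
Let A_i0 i : 0 < l 0 i -> A i i0 = 0.
Proof.
move=> li; have := L_le (row i0 W); rewrite form_rowW mu0 mulr0 (diag_form _ UU UL).
rewrite (bigD1 i) //= AE' => h.
have h2 : 0 <= \sum_(j | j != i) l 0 j * (row i0 W *m U^T) 0 j ^+ 2.
  by apply: sumr_ge0 => j _; rewrite mulr_ge0 ?sqr_ge0.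
have h3 : l 0 i * A i i0 ^+ 2 <= 0 by lra.
by apply/eqP; rewrite -sqrf_eq0 eq_le sqr_ge0 andbT -(pmulr_rle0 _ li).
Qed.

(** Conversely the kernel of L has zero energy for L0, hence is orthogonal to
    the other w_k: both kernels are the same line. *)
Let A_ker i k : k != i0 -> ~~ (0 < l 0 i) -> A i k = 0.
Proof.
move=> /mu_gt0 muk li; have li0 : l 0 i = 0.
  by apply/eqP; rewrite eq_le l0 andbT leNgt.
have := le_trans (form0_ge k (row i U)) (L0_le _).
rewrite form_rowU li0 mulr0 AE => h.
by apply/eqP; rewrite -sqrf_eq0 eq_le sqr_ge0 andbT -(pmulr_rle0 _ muk).
Qed.

Let S k := \sum_(i | 0 < l 0 i) A i k ^+ 2 / l 0 i.

Let sum_inv_eig : \sum_(i | 0 < l 0 i) (l 0 i)^-1 = \sum_(k | k != i0) S k.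
Proof.
rewrite exchange_big /=; apply: eq_bigr => i li.
rewrite -[LHS]mul1r -(sumA_row i) (bigD1 i0) //= A_i0 // expr0n add0r.
by rewrite mulr_suml.
Qed.

(** S_k is the value on w_k of the pseudo-inverse of L. Testing the comparison of
    forms on the vector v obtained by applying that pseudo-inverse to w_k gives
    mu_k S_k^2 <= c1 S_k, since S_k is both the energy of v for L and the
    coordinate of v along w_k. *)
Let S_le k : k != i0 -> S k <= c1 / mu 0 k.
Proof.
move=> /mu_gt0 muk; (* The coordinates in the basis U of the pseudo-inverse applied to w_k. *)
pose a : 'rV[R]_n := \row_i if 0 < l 0 i then A i k / l 0 i else 0.
have aS : (a *m U *m W^T) 0 k = S k.
  rewrite -mulmxA -/A mxE /S [RHS]big_mkcond; apply: eq_bigr => i _.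
  by rewrite !mxE; case: ifP => _; rewrite ?mul0r // mulrAC.
have aL : (a *m U *m L *m (a *m U)^T) 0 0 = S k.
  rewrite (diag_form _ UU UL) -(mulmxA a) UU mulmx1 /S [RHS]big_mkcond.
  apply: eq_bigr => i _; rewrite !mxE; case: ifP => li; last by rewrite expr0n mulr0.
  by field; rewrite gt_eqF.
have := le_trans (form0_ge k (a *m U)) (L0_le _); rewrite aS aL => h.
have S0 : 0 <= S k.
  by apply: sumr_ge0 => i li; rewrite divr_ge0 ?sqr_ge0 // ltW.
rewrite ler_pdivlMr //; move: S0; rewrite le_eqVlt => /predU1P[<-|S0].
  by rewrite mul0r ltW.
by rewrite -(ler_pM2l S0); move: h; lra.
Qed.

(** Jensen's inequality for 1 / x: the A_ik^2 are weights of total mass 1 on the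
    positive eigenvalues of L, with mean the energy of w_k for L, at most c2 mu_k.
    The tangent line of 1 / x at that bound does the work. *)
Let S_ge k : k != i0 -> (c2 * mu 0 k)^-1 <= S k.
Proof.
move=> ki; have muk := mu_gt0 ki; set t := (c2 * mu 0 k)^-1.
have cm : 0 < c2 * mu 0 k by rewrite mulr_gt0.
have w1 : \sum_(i | 0 < l 0 i) A i k ^+ 2 = 1.
  rewrite -(sumA_col k) [RHS](bigID (fun i => 0 < l 0 i)) /= [X in _ + X]big1 ?addr0 //.
  by move=> i li; rewrite A_ker // expr0n.
have wL : \sum_(i | 0 < l 0 i) l 0 i * A i k ^+ 2 <= c2 * mu 0 k.
  rewrite -form_rowW; apply: le_trans (L_le _); rewrite (diag_form _ UU UL) [leLHS]big_mkcond.
  apply: ler_sum => i _; case: ifP => _; first by rewrite AE'.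
  by rewrite mulr_ge0 ?sqr_ge0.
have : \sum_(i | 0 < l 0 i) (2 * t * A i k ^+ 2 - t ^+ 2 * (l 0 i * A i k ^+ 2)) <= S k.
  apply: ler_sum => i li; rewrite -subr_ge0.
  have -> : A i k ^+ 2 / l 0 i - (2 * t * A i k ^+ 2 - t ^+ 2 * (l 0 i * A i k ^+ 2)) =
     (A i k * (1 - t * l 0 i)) ^+ 2 / l 0 i by field; rewrite gt_eqF.
  by rewrite divr_ge0 ?sqr_ge0.
rewrite sumrB -!mulr_sumr w1 => h; apply: le_trans h.
have : t ^+ 2 * (\sum_(i | 0 < l 0 i) l 0 i * A i k ^+ 2) <= t ^+ 2 * (c2 * mu 0 k).
  by rewrite ler_wpM2l ?sqr_ge0.
have -> : t ^+ 2 * (c2 * mu 0 k) = t by rewrite /t; field; rewrite !gt_eqF.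
lra.
Qed.

(** Equivalent energy forms with a one-dimensional kernel have pseudo-inverses of
    equivalent trace. The trace of the pseudo-inverse of L is computed in the
    eigenbasis of L0, where it can be bounded term by term. *)
Lemma spectral_compare :
  c2^-1 * \sum_(k | k != i0) (mu 0 k)^-1 <= \sum_(i | 0 < l 0 i) (l 0 i)^-1 <=
  c1 * \sum_(k | k != i0) (mu 0 k)^-1.
Proof.
rewrite sum_inv_eig !mulr_sumr; apply/andP; split; apply: ler_sum => k ki.
  by rewrite -invfM S_ge.
exact: S_le.
Qed.

Lemma eig_le (m : R) : (forall k, mu 0 k <= m) -> forall i, l 0 i <= c2 * m.
Proof.
move=> hm i; rewrite -form_rowU; apply: le_trans (L_le _) _.
rewrite ler_pM2l // (diag_form _ WW WL).
rewrite -[m]mulr1 -(sumA_row i) mulr_sumr; apply: ler_sum => k _.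
by rewrite AE ler_wpM2r ?sqr_ge0.
Qed.

End SpectralCompare.

(** * Laplacians as energy forms *)

Definition weighted_lap (R : pzRingType) (T : finType) (b : T -> T -> R)
    (f : T -> R) (x : T) : R :=
  \sum_y b x y * (f x - f y).

(** Summation by parts on a graph; it makes the Laplacian symmetric. *)
Lemma dirichlet_lap (R : comPzRingType) (T : finType) (b : T -> T -> R) (f g : T -> R) :
  (forall x y, b x y = b y x) ->
  \sum_x \sum_y b x y * ((f x - f y) * (g x - g y)) =
  2 * \sum_x f x * weighted_lap b g x.
Proof.
move=> bsym.
have h : \sum_x \sum_y b x y * (f y * (g x - g y)) =
    - \sum_x f x * weighted_lap b g x.
  rewrite exchange_big /= -sumrN; apply: eq_bigr => y _.
  rewrite /weighted_lap mulr_sumr -sumrN; apply: eq_bigr => x _.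
  by rewrite bsym; ring.
rewrite mulr2n mulrDl !mul1r -[X in _ = _ + X]opprK -h -sumrB.
apply: eq_bigr => x _; rewrite /weighted_lap mulr_sumr -sumrB.
by apply: eq_bigr => y _; ring.
Qed.

Definition adj_weight (R : pzSemiRingType) (T : finType) (e : rel T) (x y : T) : R :=
  (e x y)%:R.

Lemma adj_weight_sum (R : pzSemiRingType) (T : finType) (e : rel T) x (F : T -> R) :
  \sum_y adj_weight R e x y * F y = \sum_(y | e x y) F y.
Proof.
rewrite [RHS]big_mkcond; apply: eq_bigr => y _.
by rewrite /adj_weight; case: (e x y); rewrite ?mul1r ?mul0r.
Qed.

Definition energy (R : pzRingType) (T : finType) (b : T -> T -> R) (f : T -> R) : R :=
  \sum_x \sum_y b x y * (f x - f y) ^+ 2.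

Definition row_of (R : Type) (T : finType) (f : T -> R) : 'rV[R]_#|T| :=
  \row_j f (enum_val j).

Definition fun_of_row (R : Type) (T : finType) (v : 'rV[R]_#|T|) (x : T) : R :=
  v 0 (enum_rank x).

Section LaplacianForm.
Variables (R : realType) (T : finType) (b : T -> T -> R).
Hypothesis bsym : forall x y, b x y = b y x.

Lemma laplacian_sym : (laplacian b)^T = laplacian b.
Proof.
apply/matrixP => i j; rewrite !mxE eq_sym.
by case: eqP => [->|_] //; rewrite bsym.
Qed.

Lemma row_of_laplacian (f : T -> R) :
  row_of f *m laplacian b = row_of (weighted_lap b f).
Proof.
apply/rowP => j; rewrite !mxE; under eq_bigr do rewrite !mxE.
rewrite (bigD1 j) //= eqxx /weighted_lap [RHS](bigD1 (enum_val j)) //= subrr mulr0 add0r.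
under [RHS]eq_bigr do rewrite mulrBr.
rewrite sumrB -mulr_suml mulrC; congr (_ + _).
rewrite -sumrN (reindex (@enum_val T T)) /=; last first.
  by exists enum_rank => x _; rewrite ?enum_valK ?enum_rankK.
apply: eq_big => [i|i ij]; first by rewrite (inj_eq enum_val_inj).
by rewrite (negPf ij) bsym mulrN mulrC.
Qed.

(** The factor 1/2 appears because [energy] counts every edge in both
    directions. *)
Lemma laplacian_form (f : T -> R) :
  (row_of f *m laplacian b *m (row_of f)^T) 0 0 = 2^-1 * energy b f.
Proof.
have -> : energy b f = 2 * \sum_x f x * weighted_lap b f x.
  by rewrite -dirichlet_lap.
rewrite mulrA mulVf ?pnatr_eq0 // mul1r row_of_laplacian mxE.
rewrite [RHS](reindex (@enum_val T T)) /=; last first.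
  by exists enum_rank => x _; rewrite ?enum_valK ?enum_rankK.
by apply: eq_bigr => i _; rewrite !mxE mulrC.
Qed.

Lemma row_ofK (v : 'rV[R]_#|T|) : row_of (fun_of_row v) = v.
Proof. by apply/rowP => j; rewrite mxE /fun_of_row enum_valK. Qed.

Lemma laplacian_psd : (forall x y, 0 <= b x y) -> psdmx (laplacian b).
Proof.
move=> b0; split; first exact: laplacian_sym.
move=> v; rewrite -[v]row_ofK laplacian_form mulr_ge0 ?invr_ge0 //.
by do 2! (apply: sumr_ge0 => ? _); rewrite mulr_ge0 ?sqr_ge0.
Qed.

End LaplacianForm.

Lemma energy_adj_weight (R : realType) (T : finType) (e : rel T) (f : T -> R) :
  energy (adj_weight R e) f = \sum_x \sum_(y | e x y) (f x - f y) ^+ 2.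
Proof. by apply: eq_bigr => x _; exact: adj_weight_sum. Qed.

(** * Energy of a fuzz against energy of its base graph *)

Section Walks.
Variables (R : realFieldType) (T : finType) (e : rel T) (D : nat).
Hypothesis esym : symmetric e.
Hypothesis degD : forall x, (#|e x| <= D)%N.

Definition walk (l : nat) : rel T := fun x y =>
  [exists p : l.-tuple T, path e x p && (last x p == y)].

Lemma walkS l x y : walk l.+1 x y -> exists z, e x z && walk l z y.
Proof.
case/existsP => p; case/tupleP: p => z p /= /andP[/andP[exz pz] lz].
by exists z; rewrite exz; apply/existsP; exists p; rewrite pz.
Qed.

Lemma big_walkS l x (F : T -> R) : (forall y, 0 <= F y) ->
  \sum_(y | walk l.+1 x y) F y <= \sum_(z | e x z) \sum_(y | walk l z y) F y.
Proof.
move=> F0; rewrite (exchange_big_dep xpredT) //= big_mkcond /=; apply: ler_sum => y _.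
case: ifP => [/walkS[z ez]|_]; last by apply: sumr_ge0.
by rewrite (bigD1 z) //= lerDl; apply: sumr_ge0.
Qed.

Lemma card_walk l x : \sum_(y | walk l x y) 1 <= D%:R ^+ l :> R.
Proof.
elim: l x => [|l IH] x.
  rewrite expr0 (big_pred1 x) // => y; apply/existsP/eqP => [[p]|->].
    by rewrite tuple0 /= => /eqP.
  by exists [tuple]; rewrite /= eqxx.
apply: le_trans (big_walkS _ _ _) _ => //.
apply: (@le_trans _ _ (\sum_(z | e x z) D%:R ^+ l)); first exact: ler_sum.
by rewrite sumr_const exprS -[leLHS]mulr_natl ler_wpM2r ?exprn_ge0 // ler_nat.
Qed.

(** Splitting off the first step of a walk of length l + 1 costs a factor 2 by
    (s + t)^2 <= 2 s^2 + 2 t^2. The first step is then repeated for each of the at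
    most D^l continuations, and each remaining walk is repeated for each of the at
    most D neighbours of its starting point. *)
Fixpoint walk_const (l : nat) : R :=
  if l is l'.+1 then 2 * D%:R ^+ l' + 2 * D%:R * walk_const l' else 0.

Lemma walk_const_ge0 l : 0 <= walk_const l.
Proof. by elim: l => //= l IH; rewrite addr_ge0 // !mulr_ge0 // exprn_ge0. Qed.

Lemma walk_energy_le l (f : T -> R) :
  \sum_x \sum_(y | walk l x y) (f x - f y) ^+ 2 <=
  walk_const l * \sum_x \sum_(y | e x y) (f x - f y) ^+ 2.
Proof.
elim: l => [|l IH].
  rewrite /= mul0r big1 // => x _; rewrite big1 // => y /existsP[p].
  by rewrite tuple0 /= => /eqP ->; rewrite subrr expr0n.
set E1 := \sum_x \sum_(y | e x y) (f x - f y) ^+ 2 in IH *.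
apply: (@le_trans _ _ (\sum_x \sum_(z | e x z)
   (2 * (f x - f z) ^+ 2 * D%:R ^+ l + 2 * \sum_(y | walk l z y) (f z - f y) ^+ 2))).
  apply: ler_sum => x _; apply: le_trans (big_walkS _ _ _) _ => [y|]; first exact: sqr_ge0.
  apply: ler_sum => z _.
  apply: (@le_trans _ _ (\sum_(y | walk l z y)
     (2 * (f x - f z) ^+ 2 * 1 + 2 * (f z - f y) ^+ 2))).
    apply: ler_sum => y _; rewrite -subr_ge0.
    set LHS := (X in 0 <= X).
    have -> : LHS = (f x - f z - (f z - f y)) ^+ 2 by rewrite /LHS; ring.
    exact: sqr_ge0.
  rewrite big_split /= -!mulr_sumr lerD2r ler_wpM2l ?card_walk //.
  by apply: mulr_ge0 => //; exact: sqr_ge0.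
under eq_bigr do rewrite big_split /= -mulr_suml -!mulr_sumr.
rewrite big_split /= -mulr_suml -!mulr_sumr -/E1 [leRHS]mulrDl.
rewrite [2 * D%:R ^+ l * E1]mulrAC lerD2l -[leRHS]mulrA -[leRHS]mulrA ler_wpM2l //.
rewrite (exchange_big_dep xpredT) //=.
apply: (@le_trans _ _ (\sum_z D%:R * \sum_(y | walk l z y) (f z - f y) ^+ 2)).
  apply: ler_sum => z _; rewrite sumr_const -[leLHS]mulr_natl ler_wpM2r //.
    by apply: sumr_ge0 => y _; exact: sqr_ge0.
  rewrite ler_nat (eq_card (B := e z)) // => x; by rewrite unfold_in /= esym.
by rewrite -mulr_sumr ler_wpM2l.
Qed.

Definition fuzz_const r : R := \sum_(l < r.+1) walk_const l.

Lemma fuzz_energy_le r (f : T -> R) :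
  \sum_x \sum_(y | fuzz r e x y) (f x - f y) ^+ 2 <=
  fuzz_const r * \sum_x \sum_(y | e x y) (f x - f y) ^+ 2.
Proof.
apply: (@le_trans _ _ (\sum_(l < r.+1) \sum_x \sum_(y | walk l x y) (f x - f y) ^+ 2)).
  rewrite exchange_big /=; apply: ler_sum => x _.
  rewrite (exchange_big_dep xpredT) //= big_mkcond /=; apply: ler_sum => y _.
  case: ifP => [/andP[_ /existsP[l wl]]|_]; last by apply: sumr_ge0 => l _; exact: sqr_ge0.
  by rewrite (bigD1 l) //= lerDl; apply: sumr_ge0 => ? _; exact: sqr_ge0.
by rewrite /fuzz_const mulr_suml; apply: ler_sum => l _; exact: walk_energy_le.
Qed.

Hypothesis eirr : irreflexive e.

Lemma sub_fuzz r x y : (0 < r)%N -> e x y -> fuzz r e x y.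
Proof.
move=> r0 exy; apply/andP; split; first by apply: contraTneq exy => ->; rewrite eirr.
have r1 : (1 < r.+1)%N by rewrite ltnS.
apply/existsP; exists (Ordinal r1); apply/existsP; exists [tuple y].
by rewrite /= exy eqxx.
Qed.

End Walks.

Section BoundedSusceptances.
Variables (R : realType) (T : finType) (e : rel T) (r D : nat).
Variables (lo hi : R) (b : T -> T -> R).
Hypotheses (esym : symmetric e) (eirr : irreflexive e).
Hypothesis degD : forall x, (#|e x| <= D)%N.
Hypotheses (r0 : (0 < r)%N) (lo0 : 0 < lo).
Hypothesis hb : bounded_susceptances (fuzz r e) lo hi b.

Lemma susceptance_ge0 x y : 0 <= b x y.
Proof.
have [_ b0 blh] := hb; case: (boolP (fuzz r e x y)) => [/blh/andP[+ _]|/b0 -> //].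
exact/le_trans/ltW.
Qed.

(** Lattice edges are fuzz edges, and those have weight at least [lo]. *)
Lemma energy_ge (f : T -> R) : energy (adj_weight R e) f <= lo^-1 * energy b f.
Proof.
have [_ b0 blh] := hb.
rewrite mulrC ler_pdivlMr // mulrC energy_adj_weight mulr_sumr; apply: ler_sum => x _.
rewrite mulr_sumr big_mkcond; apply: ler_sum => y _.
case: ifP => [exy|_]; last by rewrite mulr_ge0 ?sqr_ge0 ?susceptance_ge0.
rewrite ler_wpM2r ?sqr_ge0 //.
by have /blh/andP[] : fuzz r e x y by exact: sub_fuzz.
Qed.

Lemma energy_le (f : T -> R) : 0 <= hi ->
  energy b f <= hi * fuzz_const R D r * energy (adj_weight R e) f.
Proof.
have [_ b0 blh] := hb; move=> hi0.
rewrite energy_adj_weight -mulrA.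
apply: le_trans (ler_wpM2l hi0 (fuzz_energy_le esym degD r f)).
rewrite mulr_sumr; apply: ler_sum => x _; rewrite mulr_sumr [leRHS]big_mkcond.
apply: ler_sum => y _; case: ifP => [/blh/andP[_ bh]|/negbT/b0 ->]; last by rewrite mul0r.
by rewrite ler_wpM2r ?sqr_ge0.
Qed.

End BoundedSusceptances.

(** * Eigenbases of the path and of the lattice *)

Definition path_adj (n : nat) : rel 'I_n := fun a b =>
  ((a : nat).+1 == b) || ((b : nat).+1 == a).
Arguments path_adj : clear implicits.

Lemma path_adj_sym n : symmetric (path_adj n).
Proof. by move=> a b; rewrite /path_adj orbC. Qed.

Definition path_eig (R : realType) (n k : nat) : R := 2 - 2 * cos (k%:R * (pi / n%:R)).

Section PathEigenbasis.
Variables (R : realType) (n : nat).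
Let N := n.+1.
Let th (k : nat) : R := k%:R * (pi / N%:R).
Let V (k a : nat) : R := cos (th k * (a%:R + 2^-1)).
Let v (k a : 'I_N) : R := V k a.

Let V_end k : V k N = V k n.
Proof.
have NN : N%:R != 0 :> R by rewrite pnatr_eq0.
have s0 : sin (k%:R * pi) = 0 :> R.
  elim: k => [|k IH]; first by rewrite mul0r sin0.
  by rewrite -natr1 mulrDl mul1r sinDpi IH oppr0.
have -> : V k N = cos (k%:R * pi + th k / 2).
  by rewrite /V /th; congr cos; field.
have -> : V k n = cos (k%:R * pi - th k / 2).
  rewrite /V /th; congr cos; have : N%:R = n%:R + 1 :> R by rewrite natr1.
  by move=> Nn; move: NN; rewrite Nn => NN; field.
by rewrite cosD cosB s0 !mul0r subr0 addr0.
Qed.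

Let step_up (k a : 'I_N) : \sum_(b : 'I_N | a.+1 == b) (v k a - v k b) = V k a - V k a.+1.
Proof.
have [aN|aN] := ltnP a.+1 N.
  by rewrite (big_pred1 (Ordinal aN)).
have an : a = n :> nat by apply/eqP; rewrite eqn_leq -ltnS ltn_ord -ltnS.
rewrite an V_end subrr big_pred0 // => b.
by rewrite gtn_eqF.
Qed.

Let step_down (k a : 'I_N) : \sum_(b : 'I_N | b.+1 == a) (v k a - v k b) =
  V k a - cos (th k * (a%:R - 2^-1)).
Proof.
case: a => -[|a] aN /=.
  rewrite big_pred0 // /V sub0r add0r mulrN cosN subrr //.
rewrite (big_pred1 (Ordinal (ltnW aN))) /v /=.
  by congr (_ - cos (_ * _)); rewrite -[a.+1%:R]natr1; lra.
by move=> b; rewrite eqSS.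
Qed.

(** Sampling the cosine at the half-integers a + 1/2 makes it symmetric about
    both ends of the path, so the missing neighbours of the end points may be added
    without changing anything; the rest is the addition formula. *)
Let v_eig (k a : 'I_N) : weighted_lap (adj_weight R (path_adj N)) (v k) a =
  path_eig R N k * v k a.
Proof.
have -> : weighted_lap (adj_weight R (path_adj N)) (v k) a =
   \sum_(b : 'I_N | a.+1 == b) (v k a - v k b) +
   \sum_(b : 'I_N | b.+1 == a) (v k a - v k b).
  rewrite /weighted_lap adj_weight_sum big_mkcond.
  rewrite [X in X + _]big_mkcond [X in _ + X]big_mkcond -big_split /=.
  apply: eq_bigr => b _; rewrite /path_adj; case: eqP => [ab|_]; last by rewrite add0r.
  by rewrite -ab eqn_leq ltnNge leqnSn addr0.
rewrite step_up step_down /v /path_eig /V -/(th k).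
set x := th k * _.
have -> : th k * (a.+1%:R + 2^-1) = x + th k by rewrite /x -[a.+1%:R]natr1; ring.
have -> : th k * (a%:R - 2^-1) = x - th k.
  by rewrite /x; field.
by rewrite cosD cosB; ring.
Qed.

Let v_sqr_gt0 (k : 'I_N) : 0 < \sum_a v k a ^+ 2.
Proof.
rewrite (bigD1 ord0) //= ltr_pwDl //; last by apply: sumr_ge0 => a _; exact: sqr_ge0.
rewrite exprn_gt0 // /v /V add0r cos_gt0_pihalf //.
have p0 := pi_gt0 R.
have t0 : 0 <= th k by rewrite mulr_ge0 // divr_ge0 // ltW.
have tp : th k < pi.
  rewrite /th mulrA ltr_pdivrMr ?ltr0n // mulrC ltr_pM2l // ltr_nat; exact: ltn_ord.
by apply/andP; split; lra.
Qed.

(** Distinct eigenvalues, by injectivity of the cosine on [0, pi], force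
    orthogonality. *)
Let v_orth (k l : 'I_N) : k != l -> \sum_a v k a * v l a = 0.
Proof.
move=> kl; have e : path_eig R N k != path_eig R N l.
  have p0 := pi_gt0 R.
  have thI (m : 'I_N) : th m \in `[0, pi].
    rewrite in_itv /= mulr_ge0 ?divr_ge0 ?(ltW p0) //= /th mulrA ler_pdivrMr ?ltr0n // mulrC.
    by rewrite ler_pM2l // ler_nat ltnW.
  apply: contra kl => /eqP h; apply/eqP/val_inj => /=.
  have /cos_inj : cos (th k) = cos (th l) by move: h; rewrite /path_eig -!/(th _); lra.
  move=> /(_ (thI k) (thI l)) /mulIf.
  rewrite mulf_neq0 ?invr_eq0 ?pnatr_eq0 ?gt_eqF // => /(_ isT) /eqP.
  by rewrite eqr_nat => /eqP.
have bsym x y : adj_weight R (path_adj N) x y = adj_weight R (path_adj N) y x.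
  by rewrite /adj_weight path_adj_sym.
have : \sum_a v k a * weighted_lap (adj_weight R (path_adj N)) (v l) a =
    \sum_a v l a * weighted_lap (adj_weight R (path_adj N)) (v k) a.
  apply: (@mulfI _ 2); rewrite ?pnatr_eq0 // -!dirichlet_lap //.
  by do 2! apply: eq_bigr => ? _; rewrite (mulrC (v k _ - _)).
under eq_bigr do rewrite v_eig mulrCA.
under [RHS]eq_bigr do rewrite v_eig mulrCA (mulrC (v l _)).
rewrite -!mulr_sumr => /eqP; rewrite -subr_eq0 -mulrBl mulf_eq0 subr_eq0.
by rewrite eq_sym (negPf e) /= => /eqP.
Qed.

Lemma path_eigenbasis : exists c : 'I_N -> 'I_N -> R,
  (forall k l, \sum_a c k a * c l a = (k == l)%:R) /\
  (forall k a, weighted_lap (adj_weight R (path_adj N)) (c k) a =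
               path_eig R N k * c k a).
Proof.
pose s k := Num.sqrt (\sum_a v k a ^+ 2).
have s0 k : 0 < s k by rewrite sqrtr_gt0.
exists (fun k a => v k a / s k); split.
- move=> k l; have [<-|kl] := eqVneq k l; last first.
    under eq_bigr do rewrite mulrACA.
    by rewrite -mulr_suml v_orth // mul0r.
  under eq_bigr do rewrite mulrACA -!expr2.
  by rewrite -mulr_suml exprVn sqr_sqrtr ?divff ?gt_eqF // ltW.
- move=> k a; rewrite mulrA -v_eig /weighted_lap mulr_suml.
  by apply: eq_bigr => b _; rewrite -mulrA mulrBl.
Qed.

End PathEigenbasis.

Definition node_set (d N : nat) (x : node d N) (i : 'I_d) (b : 'I_N) : node d N :=
  [ffun j => if j == i then b else x j].

(** Adjacent nodes differ in exactly one coordinate, by one step on the path. *)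
Lemma big_lattice_adj (d N : nat) (V : nmodType) (x : node d N) (F : node d N -> V) :
  \sum_(y | lattice_adj x y) F y =
  \sum_i \sum_(b | path_adj N (x i) b) F (node_set x i b).
Proof.
pose P i (y : node d N) := path_adj N (x i) (y i) && [forall j, (j != i) ==> (x j == y j)].
transitivity (\sum_i \sum_(y | P i y) F y); last first.
  apply: eq_bigr => i _; rewrite (reindex_onto (node_set x i) (fun y => y i)) /=.
    apply: eq_bigl => b; rewrite /P ffunE eqxx eqxx andbT.
    rewrite (_ : [forall j, _] = true) ?andbT //.
    by apply/forallP => j; apply/implyP => /negPf ji; rewrite ffunE ji.
  move=> y /andP[_ /forallP xy]; apply/ffunP => j; rewrite ffunE.
  by case: eqP => [->|/eqP ji] //; have /implyP/(_ ji)/eqP := xy j.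
(* A neighbour y satisfies P i y for a single direction i. *)
rewrite (exchange_big_dep xpredT) //= [LHS]big_mkcond /=; apply: eq_bigr => y _.
case: ifP => [/existsP[i Pi]|/negbT/existsPn nP]; last first.
  by rewrite big_pred0 // => i; apply/negbTE/nP.
rewrite (big_pred1 i) // => j; apply/idP/eqP => [Pj|-> //].
apply/eqP/negP => /negP ji; case/andP: Pj => xj _; case/andP: Pi => _ /forallP/(_ j).
by rewrite ji /= => /eqP e; move: xj; rewrite /path_adj e orbb gtn_eqF.
Qed.

Lemma card_path_adj N (a : 'I_N) : (#|path_adj N a| <= 2)%N.
Proof.
have h (p : pred 'I_N) : (forall u v : 'I_N, p u -> p v -> u = v :> nat) -> (#|p| <= 1)%N.
  by move=> hp; apply/card_le1_eqP => u v pu pv; apply/val_inj/hp.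
pose p1 : pred 'I_N := fun b => a.+1 == b; pose p2 : pred 'I_N := fun b => b.+1 == a.
have c1 : (#|p1| <= 1)%N by apply: h => u v; rewrite /p1 => /eqP <- /eqP <-.
have c2 : (#|p2| <= 1)%N by apply: h => u v; rewrite /p2 => /eqP <- /eqP [].
have := leq_add c1 c2; rewrite -cardUI => /(leq_trans (leq_addr _ _)).
suff -> : #|[predU p1 & p2]| = #|path_adj N a| by [].
by apply: eq_card => b; rewrite -!topredE.
Qed.

Lemma lattice_adj_sym d N : symmetric (@lattice_adj d N).
Proof.
move=> x y; apply: eq_existsb => i; rewrite orbC; congr andb.
by apply: eq_forallb => j; rewrite (eq_sym (x j)).
Qed.

Lemma card_lattice_adj d N (x : node d N) : (#|lattice_adj x| <= 2 * d)%N.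
Proof.
have := @big_lattice_adj d N int x (fun=> 1).
rewrite sumr_const => h; rewrite -(ler_nat int) [leLHS]h.
apply: (@le_trans _ _ (\sum_(i < d) 2%:R)); last by rewrite sumr_const card_ord -mulrnA.
by apply: ler_sum => i _; rewrite sumr_const ler_nat card_path_adj.
Qed.

Definition lattice_eig (R : realType) (d n : nat) (kap : node d n) : R :=
  \sum_i path_eig R n (kap i).

(** The lattice is a product of paths: products of path eigenvectors are
    eigenvectors, and the eigenvalues add up. The frequencies of the eigenvectors
    range over the same set as the nodes. *)
Lemma lattice_eigenbasis (R : realType) (d n : nat) (N := n.+1) :
  exists w : node d N -> node d N -> R,
  (forall kap mu, \sum_x w kap x * w mu x = (kap == mu)%:R) /\
  (forall kap x, weighted_lap (adj_weight R (@lattice_adj d N)) (w kap) x =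
                 lattice_eig R kap * w kap x).
Proof.
have [c [cc ceig]] := path_eigenbasis R n.
exists (fun kap x : node d N => \prod_i c (kap i) (x i)); split.
- move=> kap mu; under eq_bigr do rewrite -big_split /=.
  rewrite -(bigA_distr_bigA (fun i a => c (kap i) a * c (mu i) a)) /=.
  under eq_bigr do rewrite cc.
  have [->|/eqP km] := eqVneq kap mu; first by rewrite big1 // => i _; rewrite eqxx.
  have [i kmi] : exists i, kap i != mu i.
    apply/existsP; apply: contra_notT km => /existsPn h; apply/ffunP => i.
    by have := h i; rewrite negbK => /eqP.
  by rewrite (bigD1 i) //= (negPf kmi) mul0r.
- move=> kap x; rewrite /weighted_lap adj_weight_sum big_lattice_adj /lattice_eig mulr_suml.
  apply: eq_bigr => i _; rewrite (bigD1 i) //= mulrA -ceig /weighted_lap.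
  rewrite adj_weight_sum mulr_suml.
  apply: eq_bigr => b _; rewrite [X in _ - X](bigD1 i) //= ffunE eqxx mulrBl.
  congr (_ - _ * _).
  by apply: eq_bigr => j /negPf ji; rewrite ffunE ji.
Qed.

(** * Asymptotics of the inverse spectrum of the lattice *)

Lemma sin_le (R : realType) (t : R) : 0 <= t -> sin t <= t.
Proof.
move=> t0.
have d (s : R) : is_derive s (1 : R) (fun u => sin u - u) (cos s - 1).
  exact: is_deriveB.
have := nonincreasing_of_derive d _ t0; rewrite sin0 subrr subr_le0; apply.
by move=> s _; rewrite subr_le0 cos_le1.
Qed.

Lemma cos_ge_quadratic (R : realType) (t : R) : 0 <= t -> 1 - t ^+ 2 / 2 <= cos t.
Proof.
move=> t0.
have d (s : R) : is_derive s (1 : R) (fun u => 1 - 2^-1 * (u * u) - cos u) (sin s - s).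
  by apply: is_derive_eq; rewrite /GRing.scale /=; field.
have := nonincreasing_of_derive d _ t0; rewrite cos0 mulr0 mulr0 subr0 subrr => h.
have : 1 - 2^-1 * (t * t) - cos t <= 0 by apply: h => s s0; rewrite subr_le0 sin_le.
lra.
Qed.

(** On [0, 2] the bound t - t^3 / 6 is at least t (1 - 4 / 6). *)
Lemma sin_ge_third (R : realType) (t : R) : 0 <= t <= 2 -> t / 3 <= sin t.
Proof.
move=> /andP[t0 t2].
have d (s : R) : is_derive s (1 : R) (fun u => u - 6^-1 * (u * (u * u)) - sin u)
    (1 - s ^+ 2 / 2 - cos s).
  by apply: is_derive_eq; rewrite /GRing.scale /=; field.
have := nonincreasing_of_derive d _ t0; rewrite sin0 !mul0r mulr0 !subr0 => h.
have : t - 6^-1 * (t * (t * t)) - sin t <= 0.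
  by apply: h => s s0; rewrite subr_le0 cos_ge_quadratic.
have : t * (t * t) <= t * 4 by rewrite ler_wpM2l //; nra.
lra.
Qed.

(** With theta = k pi / N the eigenvalue is 2 - 2 cos theta, or
    4 sin^2 (theta / 2); this is at most theta^2 and at least theta^2 / 9, and pi
    lies between 2 and 4. *)
Lemma path_eig_bounds (R : realType) (N k : nat) : (k <= N)%N -> (0 < N)%N ->
  4 / 9 * (k%:R / N%:R) ^+ 2 <= path_eig R N k <= 16 * (k%:R / N%:R) ^+ 2.
Proof.
move=> kN N0; have p2 := pi_ge2 R; have p4 : pi <= 4 :> R by have := pihalf_lt2 R; lra.
set x := k%:R / N%:R; rewrite /path_eig.
have -> : k%:R * (pi / N%:R) = x * pi :> R by rewrite /x; ring.
have x0 : 0 <= x by rewrite divr_ge0.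
have x1 : x <= 1 by rewrite ler_pdivrMr ?ltr0n // mul1r ler_nat.
have th0 : 0 <= x * pi by rewrite mulr_ge0 // pi_ge0.
have xp2 : 2 * x <= x * pi by rewrite [leLHS]mulrC ler_wpM2l.
have xp4 : x * pi <= 4 * x by rewrite [leRHS]mulrC ler_wpM2l.
have xp : x * pi <= pi by rewrite ler_piMl // pi_ge0.
apply/andP; split.
  have -> : cos (x * pi) = 1 - 2 * sin (x * pi / 2) ^+ 2.
    have := cos_mulr2n (x * pi / 2); rewrite cos2sin2 mulr2n -splitr => ->; ring.
  have s3 : x / 3 <= sin (x * pi / 2).
    apply: le_trans (sin_ge_third _); first lra.
    by apply/andP; split; lra.
  have : (x / 3) ^+ 2 <= sin (x * pi / 2) ^+ 2.
    by rewrite lerXn2r ?nnegrE // ?divr_ge0 // (le_trans _ s3) ?divr_ge0.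
  lra.
have := cos_ge_quadratic th0.
have : (x * pi) ^+ 2 <= (4 * x) ^+ 2 by rewrite lerXn2r ?nnegrE // mulr_ge0.
rewrite !exprMn; lra.
Qed.

Definition harmonic (R : fieldType) (N : nat) : R := \sum_(1 <= j < N) j%:R^-1.

Lemma ln_le_harmonic (R : realType) (N : nat) : (0 < N)%N -> ln N%:R <= harmonic R N.
Proof.
case: N => // N _; elim: N => [|N IH]; first by rewrite ln1 /harmonic big_geq.
rewrite /harmonic big_nat_recr //=; apply: le_trans (lerD IH (lexx _)).
have -> : N.+2%:R = N.+1%:R * (1 + N.+1%:R^-1) :> R.
  by rewrite mulrDr mulr1 divff ?pnatr_eq0 // natr1.
rewrite lnM ?posrE ?ltr0n ?addr_gt0 ?invr_gt0 ?ltr0n // lerD2l le_ln1Dx //.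
by rewrite (lt_trans (ltrN10 R)) // invr_gt0 ltr0n.
Qed.

Lemma harmonic_le (R : realType) (N : nat) : (0 < N)%N -> harmonic R N <= 1 + ln N%:R.
Proof.
case: N => // -[|N] _; first by rewrite ln1 /harmonic big_geq ?addr0.
suff : harmonic R N.+2 <= 1 + ln N.+1%:R.
  by move/le_trans; apply; rewrite lerD2l ler_ln ?posrE ?ltr0n // ler_nat.
elim: N => [|N IH]; first by rewrite /harmonic big_nat1 invr1 ln1 addr0.
rewrite /harmonic big_nat_recr //=; apply: le_trans (lerD IH (lexx _)) _.
rewrite -addrA lerD2l.
have n2 : N.+2%:R != 0 :> R by rewrite pnatr_eq0.
have e : N.+1%:R = N.+2%:R * (1 + - N.+2%:R^-1) :> R.
  rewrite mulrDr mulr1 mulrN divff //; have h : N.+2%:R = N.+1%:R + 1 :> R by rewrite natr1.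
  by rewrite h; lra.
have i0 : 0 < 1 + - N.+2%:R^-1 :> R.
  by rewrite subr_gt0 invf_lt1 ?ltr0n // ltr1n.
rewrite e lnM ?posrE ?ltr0n // -addrA gerDl.
have : ln (1 + - N.+2%:R^-1) <= - N.+2%:R^-1 :> R.
  by rewrite le_ln1Dx // ltrN2 invf_lt1 ?ltr0n // ltr1n.
by rewrite -[in X in _ -> X](addNr N.+2%:R^-1) lerD2r.
Qed.

(** Telescoping: the partial sums up to N are at most 2 - 1 / N. *)
Lemma sum_inv_sqr_le (R : realFieldType) (N : nat) :
  \sum_(1 <= j < N) (j%:R ^+ 2)^-1 <= 2 :> R.
Proof.
case: N => [|[|N]]; [by rewrite big_geq|by rewrite big_geq|].
suff : \sum_(1 <= j < N.+2) (j%:R ^+ 2)^-1 <= 2 - N.+1%:R^-1 :> R.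
  by move/le_trans; apply; rewrite gerBl invr_ge0.
elim: N => [|N IH]; first by rewrite big_nat1 expr1n invr1; lra.
rewrite big_nat_recr //=; apply: le_trans (lerD IH (lexx _)) _.
rewrite -[N.+2%:R]natr1; set x := N.+1%:R : R.
have x0 : 0 < x by rewrite ltr0n.
have x1 : 0 < x + 1 by rewrite addr_gt0.
rewrite -subr_ge0.
have -> : 2 - (x + 1)^-1 - (2 - x^-1 + ((x + 1) ^+ 2)^-1) = (x * (x + 1) ^+ 2)^-1.
  by field; rewrite !gt_eqF.
by rewrite invr_ge0 mulr_ge0 ?exprn_ge0 // ltW.
Qed.

Definition freq_sqr (R : pzSemiRingType) (d N : nat) (kap : node d N) : R :=
  \sum_i (kap i)%:R ^+ 2.

Lemma freq_sqr_gt0 (R : numDomainType) d n (kap : node d n.+1) :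
  kap != [ffun=> ord0] -> 0 < freq_sqr R kap.
Proof.
move=> k0; have [i ki] : exists i, kap i != ord0.
  apply/existsP; apply: contraNT k0 => /existsPn h; apply/eqP/ffunP => i.
  by rewrite ffunE; have := h i; rewrite negbK => /eqP.
rewrite /freq_sqr (bigD1 i) //= ltr_pwDl ?exprn_gt0 ?ltr0n ?lt0n //.
by apply: sumr_ge0 => j _; rewrite exprn_ge0.
Qed.

Lemma lattice_eig_bounds (R : realType) d n (kap : node d n.+1) :
  4 / 9 / n.+1%:R ^+ 2 * freq_sqr R kap <= lattice_eig R kap <=
  16 / n.+1%:R ^+ 2 * freq_sqr R kap.
Proof.
have e (c x : R) : c / n.+1%:R ^+ 2 * x ^+ 2 = c * (x / n.+1%:R) ^+ 2.
  by rewrite expr_div_n [RHS]mulrA [LHS]mulrAC.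
rewrite /freq_sqr /lattice_eig !mulr_sumr; apply/andP; split; apply: ler_sum => i _;
  by rewrite e; have /andP[] := path_eig_bounds R (ltnW (ltn_ord (kap i))) (ltn0Sn n).
Qed.

Lemma lattice_eig0 (R : realType) d n : lattice_eig R ([ffun=> ord0] : node d n.+1) = 0.
Proof.
rewrite /lattice_eig big1 // => i _.
by rewrite ffunE /path_eig mul0r cos0 mulr1 subrr.
Qed.

Lemma lattice_eig_gt0 (R : realType) d n (kap : node d n.+1) :
  kap != [ffun=> ord0] -> 0 < lattice_eig R kap.
Proof.
move=> k0; have /andP[h _] := lattice_eig_bounds R kap; apply: lt_le_trans h.
by rewrite mulr_gt0 ?freq_sqr_gt0 // divr_gt0 ?exprn_gt0 // divr_gt0.
Qed.

Lemma lattice_eig_le (R : realType) d n (kap : node d n) :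
  lattice_eig R kap <= 4 * d%:R.
Proof.
rewrite mulr_natr; apply: (@le_trans _ _ (\sum_(i < d) 4)).
  apply: ler_sum => i _; rewrite /path_eig.
  by have := cos_geN1 ((kap i)%:R * (pi / n%:R) : R); lra.
by rewrite sumr_const card_ord.
Qed.

Definition inv_sqr_sum (R : fieldType) (d n : nat) : R :=
  \sum_(kap : node d n.+1 | kap != [ffun=> ord0]) (freq_sqr R kap)^-1.

Lemma lattice_sum_bounds (R : realType) d n :
  n.+1%:R ^+ 2 / 16 * inv_sqr_sum R d n <=
  \sum_(kap : node d n.+1 | kap != [ffun=> ord0]) (lattice_eig R kap)^-1 <=
  9 / 4 * n.+1%:R ^+ 2 * inv_sqr_sum R d n.
Proof.
have N0 : 0 < n.+1%:R ^+ 2 :> R by rewrite exprn_gt0.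
rewrite /inv_sqr_sum !mulr_sumr; apply/andP; split; apply: ler_sum => kap k0;
  have /andP[h1 h2] := lattice_eig_bounds R kap; have f0 := freq_sqr_gt0 R k0;
  have e0 := lattice_eig_gt0 R k0.
- have -> : n.+1%:R ^+ 2 / 16 / freq_sqr R kap = (16 / n.+1%:R ^+ 2 * freq_sqr R kap)^-1.
    by move: N0 f0; set x := n.+1%:R ^+ 2; move=> *; field; rewrite !gt_eqF.
  by rewrite lef_pV2 // posrE mulr_gt0 // divr_gt0.
- have -> : 9 / 4 * n.+1%:R ^+ 2 / freq_sqr R kap = (4 / 9 / n.+1%:R ^+ 2 * freq_sqr R kap)^-1.
    by move: N0 f0; set x := n.+1%:R ^+ 2; move=> *; field; rewrite !gt_eqF.
  by rewrite lef_pV2 // posrE mulr_gt0 // divr_gt0 // divr_gt0.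
Qed.

Lemma sum_ord_neq0 (R : zmodType) n (F : nat -> R) :
  \sum_(a < n.+1 | a != ord0) F a = \sum_(1 <= j < n.+1) F j.
Proof.
by rewrite big_mkcond big_ord_recl /= add0r big_add1 big_mkord.
Qed.

Lemma inv_sqr_sum1_bounds (R : realFieldType) n : (0 < n)%N -> 1 <= inv_sqr_sum R 1 n <= 2.
Proof.
move=> n0; have -> : inv_sqr_sum R 1 n = \sum_(1 <= j < n.+1) (j%:R ^+ 2)^-1.
  rewrite -(sum_ord_neq0 _ (fun j => (j%:R ^+ 2)^-1)) /inv_sqr_sum.
  rewrite (reindex (fun a : 'I_n.+1 => [ffun=> a] : node 1 n.+1)) /=; last first.
    exists (fun kap => kap ord0) => [a _|kap _]; first by rewrite ffunE.
    by apply/ffunP => i; rewrite ffunE (ord1 i); congr (kap _); apply: val_inj.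
  apply: eq_big => [a|a _]; last by rewrite /freq_sqr big_ord1 ffunE.
  congr negb; apply/eqP/eqP => [/ffunP/(_ ord0)|->]; rewrite ?ffunE //.
rewrite sum_inv_sqr_le andbT; case: n n0 => // n _.
rewrite big_ltn // expr1n invr1 lerDl; apply: sumr_ge0 => i _.
by rewrite invr_ge0 exprn_ge0.
Qed.

Lemma sum_ord_lt_const (R : zmodType) (n m : nat) (c : R) : (m <= n)%N ->
  \sum_(k < n | (k < m)%N) c = c *+ m.
Proof. by move=> mn; rewrite -(big_ord_widen n (fun=> c)) // sumr_const card_ord. Qed.

(** Below, only the pairs k < j are kept: there are j of them for each j, each
    contributing at least 1 / (2 j^2). Above, 1 / (j^2 + k^2) is replaced by the
    inverse square of the larger coordinate; there are j + 1 <= 2 j pairs k <= j,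
    and the other half of the square is symmetric. *)
Lemma inv_sqr_sum2_bounds (R : realFieldType) n :
  2^-1 * harmonic R n.+1 <= inv_sqr_sum R 2 n <= 4 * harmonic R n.+1.
Proof.
pose g (j k : nat) : R := (j%:R ^+ 2 + k%:R ^+ 2)^-1.
have -> : inv_sqr_sum R 2 n =
    \sum_(j < n.+1) \sum_(k < n.+1) if (j != ord0) || (k != ord0) then g j k else 0.
  rewrite pair_bigA /= /inv_sqr_sum big_mkcond.
  rewrite (reindex (fun p : 'I_n.+1 * 'I_n.+1 =>
    [ffun i : 'I_2 => if i == ord0 then p.1 else p.2] : node 2 n.+1)) /=; last first.
    exists (fun kap => (kap ord0, kap ord_max)) => [[a b] _|kap _]; first by rewrite !ffunE.
    apply/ffunP => i; rewrite ffunE; case: eqP => [->|/eqP i0] //.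
    by congr (kap _); apply: val_inj; case: i i0 => -[|[|i]].
  apply: eq_bigr => -[a b] _ /=.
  have -> : ([ffun i : 'I_2 => if i == ord0 then a else b] != [ffun=> ord0]) =
      (a != ord0) || (b != ord0).
    rewrite -negb_and; congr negb; apply/eqP/andP => [/ffunP h|[/eqP -> /eqP ->]].
      by have := h ord0; have := h ord_max; rewrite !ffunE /= => -> ->.
    by apply/ffunP => i; rewrite !ffunE if_same.
  case: ifP => // _; rewrite /freq_sqr /g !big_ord_recl big_ord0 addr0 !ffunE //.
have gge0 j k : 0 <= g j k by rewrite invr_ge0 addr_ge0 // exprn_ge0.
have jpos (j : 'I_n.+1) : j != ord0 -> 0 < (j : nat)%:R :> R by rewrite ltr0n lt0n.
apply/andP; split.
  rewrite /harmonic -(sum_ord_neq0 _ (fun j => j%:R^-1)) mulr_sumr big_mkcond /=.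
  apply: ler_sum => j _; case: ifP => [j0|_]; last first.
    by apply: sumr_ge0 => k _; case: ifP.
  have jp := jpos _ j0.
  apply: (@le_trans _ _ (\sum_(k < n.+1 | (k < j)%N) (2 * (j : nat)%:R ^+ 2)^-1)).
    rewrite sum_ord_lt_const ?(ltnW (ltn_ord j)) // -mulr_natr.
    by rewrite le_eqVlt; apply/orP; left; apply/eqP; field; rewrite gt_eqF.
  rewrite big_mkcond; apply: ler_sum => k _ /=; case: ifP => // kj.
  rewrite lef_pV2 ?posrE ?mulr_gt0 ?exprn_gt0 //.
    by rewrite mulr2n mulrDl mul1r lerD2l lerXn2r ?nnegrE // ler_nat ltnW.
  by rewrite ltr_pwDl ?exprn_gt0 // exprn_ge0.
pose h (j k : 'I_n.+1) : R :=
  if (j != ord0) && (k < j.+1)%N then ((j : nat)%:R ^+ 2)^-1 else 0.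
have h0 j k : 0 <= h j k by rewrite /h; case: ifP => // _; rewrite invr_ge0 exprn_ge0.
have gh (j k : 'I_n.+1) : j != ord0 -> (k <= j)%N -> g j k <= h j k.
  move=> j0 kj; rewrite /h j0 ltnS kj /= lef_pV2 ?posrE ?exprn_gt0 ?jpos //.
    by rewrite lerDl exprn_ge0.
  by rewrite ltr_pwDl ?exprn_gt0 ?jpos // exprn_ge0.
have sumh : \sum_j \sum_k h j k <= 2 * harmonic R n.+1.
  rewrite /harmonic -(sum_ord_neq0 _ (fun j => j%:R^-1)) mulr_sumr [leRHS]big_mkcond /=.
  apply: ler_sum => j _; rewrite /h; case: (boolP (j != ord0)) => j0 /=; last by rewrite big1.
  have jp := jpos _ j0.
  rewrite -big_mkcond sum_ord_lt_const ?ltn_ord // -[leLHS]mulr_natr -[j.+1%:R]natr1.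
  rewrite mulrC ler_pdivrMr ?exprn_gt0 //.
  have -> : 2 / (j : nat)%:R * (j : nat)%:R ^+ 2 = (j : nat)%:R + (j : nat)%:R :> R.
    by field; rewrite gt_eqF.
  by rewrite lerD2l ler1n lt0n.
apply: (@le_trans _ _ (\sum_j \sum_k (h j k + h k j))).
  apply: ler_sum => j _; apply: ler_sum => k _; case: ifP => [jk|_]; last by rewrite addr_ge0.
  have [kj|jk'] := leqP k j.
    have j0 : j != ord0.
      apply: contraTneq jk => j0; rewrite j0 eqxx /= negbK; apply/eqP/val_inj => /=.
      by apply/eqP; rewrite -leqn0; rewrite j0 in kj.
    by apply: le_trans (gh _ _ j0 kj) _; rewrite lerDl.
  have k0 : k != ord0 by apply: contraTneq jk' => ->.
  have -> : g j k = g k j by rewrite /g addrC.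
  by apply: le_trans (gh _ _ k0 (ltnW jk')) _; rewrite lerDr.
under eq_bigr do rewrite big_split /=.
rewrite big_split /= [X in _ + X]exchange_big /=; lra.
Qed.

(** * Loss bounds for the lattice network *)

Section LatticeNetwork.
Variables (R : realType) (d n r : nat) (lo hi : R).
Variables (alpha gamma k q tau : R) (b : node d n.+1 -> node d n.+1 -> R).
Hypotheses (alpha0 : 0 < alpha) (gamma0 : 0 < gamma) (k0 : 0 < k).
Hypotheses (q0 : 0 < q) (tau0 : 0 < tau) (r0 : (0 < r)%N) (lo0 : 0 < lo).
Hypothesis hb : bounded_susceptances (fuzz r (@lattice_adj d n.+1)) lo hi b.

Let L := laplacian b.
(* The maximum with 0 and the added 1 keep this positive on graphs without
   edges, where hi is arbitrary. *)
Let c2 : R := Num.max hi 0 * fuzz_const R (2 * d) r + 1.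

Let c2_gt0 : 0 < c2.
Proof.
rewrite ltr_wpDl // mulr_ge0 //; first by rewrite le_max lexx orbT.
by apply: sumr_ge0 => l _; exact: walk_const_ge0.
Qed.

Let bsym x y : b x y = b y x. Proof. by case: hb. Qed.

Lemma lattice_laplacian_psd : psdmx L.
Proof. by apply: laplacian_psd => // x y; exact: susceptance_ge0 hb _ _. Qed.

(** Every constant here depends on d, r and the susceptance bounds but not on the
    size of the network, which enters through N^2 and the sum over frequencies
    only. *)
Lemma lattice_spectrum : exists (U : 'M[R]_#|node d n.+1|) (l : 'rV[R]_#|node d n.+1|),
  [/\ U *m U^T = 1%:M, U *m L = diag_mx l *m U, forall i, 0 <= l 0 i,
      forall i, l 0 i <= c2 * (4 * d%:R)
    & c2^-1 * (n.+1%:R ^+ 2 / 16 * inv_sqr_sum R d n) <=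
        \sum_(i | 0 < l 0 i) (l 0 i)^-1 <=
      lo^-1 * (9 / 4 * n.+1%:R ^+ 2 * inv_sqr_sum R d n)].
Proof.
have [U [l [UU UL]]] := symmetric_spectral lattice_laplacian_psd.1.
have l0 := psdmx_eig_ge0 lattice_laplacian_psd UU UL.
have [w [worth weig]] := lattice_eigenbasis R d n.
pose W : 'M[R]_#|node d n.+1| := \matrix_(i, j) w (enum_val i) (enum_val j).
pose mu : 'rV[R]_#|node d n.+1| := \row_i lattice_eig R (enum_val i : node d n.+1).
pose a0 := adj_weight R (@lattice_adj d n.+1).
have a0sym x y : a0 x y = a0 y x by rewrite /a0 /adj_weight lattice_adj_sym.
have bij : {on xpredT, bijective (@enum_val (node d n.+1) (node d n.+1))}.
  by exists enum_rank => x _; rewrite ?enum_valK ?enum_rankK.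
have WW : W *m W^T = 1%:M.
  apply/matrixP => i j; rewrite !mxE; under eq_bigr do rewrite !mxE.
  rewrite -(inj_eq enum_val_inj) -worth.
  by rewrite [RHS](reindex (@enum_val (node d n.+1) (node d n.+1))).
have WL : W *m laplacian a0 = diag_mx mu *m W.
  have rW i : row i W = row_of (w (enum_val i)) by apply/rowP => j; rewrite !mxE.
  apply/row_matrixP => i; rewrite !row_mul rW row_of_laplacian //.
  apply/rowP => j; rewrite -row_mul mul_diag_mx !mxE.
  by rewrite weig.
pose i0 : 'I_#|node d n.+1| := enum_rank ([ffun=> ord0] : node d n.+1).
have mu0 : mu 0 i0 = 0 by rewrite mxE enum_rankK lattice_eig0.
have neq_i0 i : (i != i0) = ((enum_val i : node d n.+1) != [ffun=> ord0]).
  by rewrite -(inj_eq enum_val_inj) enum_rankK.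
have mu_gt0 i : i != i0 -> 0 < mu 0 i.
  by rewrite neq_i0 mxE; exact: lattice_eig_gt0.
have hi0 : 0 <= Num.max hi 0 by rewrite le_max lexx orbT.
have hb' : bounded_susceptances (fuzz r (@lattice_adj d n.+1)) lo (Num.max hi 0) b.
  by case: hb => h1 h2 h3; split=> // x y /h3 /andP[-> bh]; rewrite le_max bh.
have L0_le (v : 'rV[R]_#|node d n.+1|) :
    (v *m laplacian a0 *m v^T) 0 0 <= lo^-1 * (v *m L *m v^T) 0 0.
  rewrite -[v]row_ofK !laplacian_form // mulrCA ler_wpM2l ?invr_ge0 //.
  exact: energy_ge (@lattice_adj_irr d n.+1) r0 lo0 hb _.
have L_le (v : 'rV[R]_#|node d n.+1|) :
    (v *m L *m v^T) 0 0 <= c2 * (v *m laplacian a0 *m v^T) 0 0.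
  rewrite -[v]row_ofK !laplacian_form // mulrCA ler_wpM2l ?invr_ge0 //.
  apply: le_trans (energy_le (@lattice_adj_sym d n.+1) (@card_lattice_adj d n.+1) hb' _ hi0) _.
  rewrite ler_wpM2r ?lerDl //.
  by do 2! (apply: sumr_ge0 => ? _); rewrite mulr_ge0 ?sqr_ge0 // ler0n.
exists U, l; split=> //.
  by apply: (eig_le UU UL WW WL c2_gt0 L_le) => i; rewrite mxE lattice_eig_le.
have /andP[lo_le le_hi] := lattice_sum_bounds R d n.
have sumE : \sum_(i | i != i0) (mu 0 i)^-1 =
   \sum_(kap : node d n.+1 | kap != [ffun=> ord0]) (lattice_eig R kap)^-1.
  rewrite [RHS](reindex (@enum_val (node d n.+1) (node d n.+1))) /=; last first.
    by exists enum_rank => x _; rewrite ?enum_valK ?enum_rankK.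
  by apply: eq_big => [i|i _]; [exact: neq_i0|rewrite mxE].
have li0 : 0 < lo^-1 by rewrite invr_gt0.
have /andP[h1 h2] := spectral_compare UU UL WW WL l0 mu0 mu_gt0 li0 c2_gt0 L0_le L_le.
rewrite sumE in h1 h2.
apply/andP; split; [apply: le_trans h1|apply: (le_trans h2)].
  by rewrite ler_pM2l // invr_gt0.
by rewrite ler_pM2l.
Qed.

Lemma lattice_loss_P_le :
  (per_node (node d n.+1) (dapi_loss_P L alpha gamma k q tau) <= (alpha / (2 * k))%:E)%E.
Proof.
have [U [l [UU UL l0 _ _]]] := lattice_spectrum.
have T0 : (0 < #|node d n.+1|)%N by rewrite card_ffun !card_ord expn_gt0.
have := dapi_loss_P_le alpha0 gamma0 k0 q0 tau0 lattice_laplacian_psd UU UL l0.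
rewrite /per_node (dapi_loss_P_modes alpha0 gamma0 k0 q0 tau0 lattice_laplacian_psd UU UL l0).
by rewrite -EFinM !lee_fin ler_pdivrMl // ltr0n.
Qed.

Definition eta_const_lo : R :=
  alpha / (2 * k * gamma) / (1 + (gamma + k * q) * (c2 * (4 * d%:R))) / c2 / 16.

Definition eta_const_hi : R := alpha / (2 * k * gamma) / lo * (9 / 4).

Let eta_den_gt0 : 0 < 1 + (gamma + k * q) * (c2 * (4 * d%:R)).
Proof.
have c0 : 0 <= gamma + k * q by rewrite addr_ge0 ?mulr_ge0 // ltW.
by rewrite ltr_pwDl // mulr_ge0 // mulr_ge0 ?(ltW c2_gt0) // mulr_ge0.
Qed.

Lemma lattice_loss_eta_bounds (eps : R) :
  exists S : R, [/\ dapi_loss_eta L alpha gamma k q tau eps = S%:E,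
    eps ^+ 2 * (eta_const_lo * n.+1%:R ^+ 2 * inv_sqr_sum R d n) <= S
  & S <= eps ^+ 2 * (eta_const_hi * n.+1%:R ^+ 2 * inv_sqr_sum R d n)].
Proof.
have [U [l [UU UL l0 lL /andP[Sl Sh]]]] := lattice_spectrum.
have [S [-> S1 S2]] := dapi_loss_eta_bounds eps alpha0 gamma0 k0 q0 tau0
  lattice_laplacian_psd UU UL l0 lL.
have C0 : 0 < alpha / (2 * k * gamma) by rewrite divr_gt0 // !mulr_gt0.
exists S; split=> //.
  apply: le_trans S1; apply: le_trans (ler_wpM2l _ Sl).
    rewrite /eta_const_lo; set B := 1 + _.
    by rewrite le_eqVlt; apply/orP; left; apply/eqP; ring.
  by rewrite mulr_ge0 ?sqr_ge0 // ltW // divr_gt0.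
apply: (le_trans S2); apply: le_trans (ler_wpM2l _ Sh) _.
  by rewrite mulr_ge0 ?sqr_ge0 // ltW.
by rewrite /eta_const_hi le_eqVlt; apply/orP; left; apply/eqP; ring.
Qed.

Lemma eta_const_lo_gt0 : 0 < eta_const_lo.
Proof.
by rewrite /eta_const_lo !divr_gt0 // !mulr_gt0.
Qed.

Lemma eta_const_hi_gt0 : 0 < eta_const_hi.
Proof. by rewrite /eta_const_hi mulr_gt0 ?divr_gt0 // !mulr_gt0. Qed.

End LatticeNetwork.

(** For d = 1 the node count n = N turns N^2 / n into n. For d = 2 it is N^2 that
    cancels, and log n = 2 log N absorbs the constant in 1 + log N as soon as
    N >= e. *)
Lemma lattice_network_scaling (R : realType) (d : nat) (eps : R)
   (loss : nat -> \bar R) (K1 K2 : R) : d = 1%N \/ d = 2%N ->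
  0 < K1 -> 0 < K2 ->
  (forall n, exists S : R, [/\ loss n.+1 = S%:E,
    eps ^+ 2 * (K1 * n.+1%:R ^+ 2 * inv_sqr_sum R d n) <= S
  & S <= eps ^+ 2 * (K2 * n.+1%:R ^+ 2 * inv_sqr_sum R d n)]) ->
  scales_as (fun N => per_node (node d N) (loss N))
    (fun N => if d == 1%N then eps ^+ 2 * #|node d N|%:R
              else eps ^+ 2 * ln (#|node d N|%:R)).
Proof.
move=> hd K10 K20 hloss.
have e20 : 0 <= eps ^+ 2 by exact: sqr_ge0.
case: hd => ->{d} in hloss *.
  exists K1, (2 * K2); split; rewrite ?mulr_gt0 //.
  apply: filterS (nbhs_infty_gt 1) => -[//|n]; rewrite ltnS => n0.
  have [S [-> S1 S2]] := hloss n.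
  rewrite /= /per_node -EFinM !lee_fin card_ffun !card_ord expn1.
  have N0 : 0 < n.+1%:R :> R by rewrite ltr0n.
  have /andP[Z1 Z2] := inv_sqr_sum1_bounds R n0.
  rewrite ler_pdivlMl // ler_pdivrMl //; split.
    apply: le_trans S1.
    have -> : n.+1%:R * (K1 * (eps ^+ 2 * n.+1%:R)) =
        eps ^+ 2 * (K1 * n.+1%:R ^+ 2) * 1 by ring.
    rewrite [leRHS]mulrA ler_wpM2l // mulr_ge0 // mulr_ge0 // ?exprn_ge0 //; exact: ltW.
  apply: (le_trans S2).
  have -> : n.+1%:R * (2 * K2 * (eps ^+ 2 * n.+1%:R)) =
      eps ^+ 2 * (K2 * n.+1%:R ^+ 2) * 2 by ring.
  rewrite [leLHS]mulrA ler_wpM2l // mulr_ge0 // mulr_ge0 // ?exprn_ge0 //; exact: ltW.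
exists (K1 / 4), (4 * K2); split; rewrite ?mulr_gt0 ?invr_gt0 //.
apply: filterS2 (nbhs_infty_gt 0) (nbhs_infty_ger (expR (1 : R))) => -[//|n] _ Ne.
have [S [-> S1 S2]] := hloss n.
rewrite /= /per_node -EFinM !lee_fin card_ffun !card_ord.
have N0 : 0 < n.+1%:R :> R by rewrite ltr0n.
have ln1 : 1 <= ln n.+1%:R :> R by rewrite -ler_expR lnK ?posrE.
have H1 := ln_le_harmonic R (ltn0Sn n); have H2 := harmonic_le R (ltn0Sn n).
have /andP[Z1 Z2] := inv_sqr_sum2_bounds R n.
rewrite natrX lnXn // mulr2n.
rewrite ler_pdivlMl ?exprn_gt0 // ler_pdivrMl ?exprn_gt0 //; split.
  apply: le_trans S1.
  have -> : n.+1%:R ^+ 2 * (K1 / 4 * (eps ^+ 2 * (ln n.+1%:R + ln n.+1%:R))) =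
     eps ^+ 2 * (K1 * n.+1%:R ^+ 2) * (2^-1 * ln n.+1%:R) :> R by field.
  rewrite [leRHS]mulrA ler_wpM2l //; last by lra.
  by rewrite mulr_ge0 // mulr_ge0 // ?exprn_ge0 // ltW.
apply: (le_trans S2).
have -> : n.+1%:R ^+ 2 * (4 * K2 * (eps ^+ 2 * (ln n.+1%:R + ln n.+1%:R))) =
   eps ^+ 2 * (K2 * n.+1%:R ^+ 2) * (8 * ln n.+1%:R) :> R by ring.
rewrite [leLHS]mulrA ler_wpM2l //; last by lra.
by rewrite mulr_ge0 // mulr_ge0 // ?exprn_ge0 // ltW.
Qed.

Theorem proposition4p1 (R : realType) (d r : nat)
    (alpha gamma k q tau eps b_lo b_hi : R)
    (b : forall N : nat, node d N -> node d N -> R)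
    (hd : d = 1%N \/ d = 2%N) (hr : (0 < r)%N)
    (halpha : 0 < alpha) (hgamma : 0 < gamma) (hk : 0 < k) (hq : 0 < q)
    (htau : 0 < tau) (heps : 0 < eps) (hb_lo : 0 < b_lo)
    (hb : forall N : nat,
        bounded_susceptances (fuzz r (@lattice_adj d N)) b_lo b_hi (b N)) :
  scales_as
    (fun N => per_node (node d N)
       (dapi_loss_eta (laplacian (b N)) alpha gamma k q tau eps))
    (fun N => if d == 1%N then eps ^+ 2 * #|node d N|%:R
              else eps ^+ 2 * ln (#|node d N|%:R))
  /\ forall N : nat, (0 < N)%N ->
       (per_node (node d N)
          (dapi_loss_P (laplacian (b N)) alpha gamma k q tau)
        <= (alpha / (2 * k))%:E)%E.
Proof.
split; last first.
  by move=> [//|n] _; exact: lattice_loss_P_le (hb n.+1).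
apply: (lattice_network_scaling (loss := fun N =>
  dapi_loss_eta (laplacian (b N)) alpha gamma k q tau eps) hd).
- exact: (eta_const_lo_gt0 d r b_hi halpha hgamma hk hq).
- exact: (eta_const_hi_gt0 halpha hgamma hk hb_lo).
- by move=> n; exact: lattice_loss_eta_bounds.
Qed.
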